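(* Let $\psi$ be an entire function and $\varphi(z)=az+b$ with $a,b\in\mathbb{C}$, $|a|\le1$. Then $C_{\psi,\varphi}$ is a bounded cohyponormal operator on $\mathcal{F}^2$ if and only if: $\psi=\psi(0)K_{b\frac{\bar a-1}{a-1}}$ in the case $a\neq1$, and $\psi=\psi(0)K_{-b}$ in the case $a=1$.
   Context: $\mathcal{F}^2$ is the Fock space: the Hilbert space of entire functions $f$ on $\mathbb{C}$ with $\int_{\mathbb{C}}|f(z)|^2\,d\mu(z)<\infty$, where $d\mu(z)=\pi^{-1}e^{-|z|^2}\,dA(z)$, with inner product $\langle f,g\rangle=\int f\overline{g}\,d\mu$. Its reproducing kernel at $w$ is $K_w(z)=e^{\bar w z}$. The weighted composition operator is $C_{\psi,\varphi}f=\psi\cdot(f\circ\varphi)$. A bounded operator $T$ is cohyponormal if $T^*T\le TT^*$. *)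

(* Defs.v *)
(* Complex numbers are R[i]
   (mathcomp-real-closed) over an arbitrary R : realType. *)
From HB Require Import structures.
From mathcomp Require Import all_boot all_order all_algebra.
From mathcomp Require Import all_classical all_reals all_analysis.
From mathcomp Require Import complex.
Import Order.TTheory GRing.Theory Num.Theory.
Import numFieldNormedType.Exports.
Set Implicit Arguments. Unset Strict Implicit. Unset Printing Implicit Defensive.
Local Open Scope ring_scope.
Local Open Scope complex_scope.

Section Fock.
Variable R : realType.

(* R[i] with its structure of normed space over itself (topology, limits,
   complex derivative). *)
Definition Cn := (R[i])^o.

(* Complex exponential, as the sum of its power series. *)
Definition expC (z : R[i]) : R[i] :=
  limn (series (fun n => ((z : Cn) ^+ n / n`!%:R : Cn))).

(* f is entire: complex differentiable at every point of C. *)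
Definition entire (f : R[i] -> R[i]) : Prop :=
  forall z : Cn, derivable (f : Cn -> Cn) z (1 : Cn).

(* The point x + iy of C, for (x,y) in R x R. *)
Definition cpt (p : R * R) : R[i] := p.1 +i* p.2.

(* squared modulus *)
Definition abs2 (z : R[i]) : R := (complex.Re z) ^+ 2 + (complex.Im z) ^+ 2.

(* Lebesgue (area) measure on C = R x R. *)
Definition areaC := (@lebesgue_measure R \x @lebesgue_measure R)%E.

(* Gaussian density pi^-1 e^{-|z|^2}, so that d mu = gauss dA. *)
Definition gauss (p : R * R) : R := expR (- abs2 (cpt p)) / pi.

(* int |f|^2 d mu, in the extended reals *)
Definition fock_norm2E (f : R[i] -> R[i]) : \bar R :=
  (\int[areaC]_p ((abs2 (f (cpt p)) * gauss p)%:E))%E.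

(* membership in the Fock space F^2 *)
Definition inF2 (f : R[i] -> R[i]) : Prop :=
  entire f /\ (fock_norm2E f < +oo)%E.

(* ||f||^2 as a real number *)
Definition fock_norm2 (f : R[i] -> R[i]) : R := fine (fock_norm2E f).

(* <f, g> = int f conj(g) d mu  (real and imaginary parts integrated separately) *)
Definition fock_inner (f g : R[i] -> R[i]) : R[i] :=
  (Rintegral areaC setT
     (fun p => complex.Re (f (cpt p) * (g (cpt p))^*) * gauss p))
  +i*
  (Rintegral areaC setT
     (fun p => complex.Im (f (cpt p) * (g (cpt p))^*) * gauss p)).

(* reproducing kernel K_w(z) = e^{conj(w) z} *)
Definition fockK (w : R[i]) : R[i] -> R[i] := fun z => expC (w^* * z).

(* weighted composition operator C_{psi,phi} f = psi * (f o phi) *)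
Definition wcomp (psi phi : R[i] -> R[i]) (f : R[i] -> R[i]) : R[i] -> R[i] :=
  fun z => psi z * f (phi z).

(* T is a bounded operator on F^2 *)
Definition bounded_on_F2 (T : (R[i] -> R[i]) -> (R[i] -> R[i])) : Prop :=
  (forall f, inF2 f -> inF2 (T f)) /\
  exists M : R, forall f, inF2 f -> fock_norm2 (T f) <= M * fock_norm2 f.

(* S is the adjoint of T on F^2 *)
Definition is_adjoint_F2 (T S : (R[i] -> R[i]) -> (R[i] -> R[i])) : Prop :=
  (forall g, inF2 g -> inF2 (S g)) /\
  forall f g, inF2 f -> inF2 g -> fock_inner (T f) g = fock_inner f (S g).

(* T bounded and cohyponormal: T^* T <= T T^*, i.e.
   <T^*T f, f> = ||T f||^2 <= ||T^* f||^2 = <T T^* f, f> for f in F^2. *)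
Definition cohyponormal_F2 (T : (R[i] -> R[i]) -> (R[i] -> R[i])) : Prop :=
  bounded_on_F2 T /\
  exists S, is_adjoint_F2 T S /\
    forall f, inF2 f -> fock_norm2 (T f) <= fock_norm2 (S f).

End Fock.

(* Main.v *)
(* Write T for the operator, U_q for the Weyl unitaries and D_a f = f (a .).

   If T is cohyponormal and a <> 1, then phi fixes p = b / (1 - a), so K_p is an
   eigenvector of T^* for the eigenvalue conj (psi p).  As T^* is hyponormal, K_p
   is also an eigenvector of T for psi p, and psi K_p(phi) = psi(p) K_p determines
   psi.  If a = 1, boundedness of T tested on normalized kernels bounds
   psi(z) e^(conj b z), which is constant by Liouville.  Conversely, for psi of the
   given form, T is a multiple of U_p D_a U_q with q = - p (or a = 1), and the
   adjoint of D_a is D_(conj a), which satisfies |D_(conj a) f| = |D_a f|.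

   The complex analysis rests on Goursat's theorem for rectangles: composing with
   exp turns circles into vertical segments, so the vertical means of a
   2 pi i-periodic entire function H are independent of the abscissa.  This gives
   the mean value property, Liouville's theorem and, after averaging Gaussian
   integrals over rotations, the reproducing property and the adjoint of D_a. *)
Require Import Defs.
From HB Require Import structures.
From mathcomp Require Import all_boot all_order all_algebra.
From mathcomp Require Import all_classical all_reals all_analysis.
From mathcomp Require Import complex ring lra measurable_realfun.
Import Order.TTheory GRing.Theory Num.Theory.
Import numFieldNormedType.Exports Normc.
Local Open Scope classical_set_scope.
Local Open Scope ring_scope.
Local Open Scope complex_scope.

(** * Complex differentiability in epsilon-delta form and closure properties of entire functions *)

Section ComplexDerivative.
Context {R : realType}.
Implicit Types (f g : R[i] -> R[i]) (z w d : R[i]).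

(** The passage from an eigenvector of T^* to one of T is a norm expansion: |T K_p|^2 <= |T^* K_p|^2
    = |psi p|^2 |K_p|^2, after which |T K_p - psi(p) K_p|^2 expands to something at most 0. A
    translation has in general no fixed point, so for a = 1 boundedness alone has to give the form
    of psi. In the converse, the Weyl unitaries drop out of the norms and leave |D_a U_q f| against
    |D_(conj a) U_(-p) f|: q = -p puts the same function under both dilations, and a = 1 removes the
    dilations. Rectangles keep every contour integral a real integral over an interval; circles come
    back only through exp. The adjoint of D_a is split by polar form: the unimodular factor is a
    symmetry of the measure, while a factor r > 0 yields two integrands that are related only
    through their means over each circle centred at 0. The Weyl unitaries carry what is proved at
    the point 0 (evaluation, its bound) to every other point. *)

Definition cdiff f z d := forall e : R, 0 < e -> exists2 r : R, 0 < r &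
  forall h, normc h < r -> normc (f (z + h) - f z - d * h) <= e * normc h.

Lemma complex_normE (z : R[i]) : `|z| = (normc z)%:C.
Proof. by []. Qed.

(** The order on [R[i]] only compares numbers with equal imaginary parts, so the epsilons and radii
    supplied by the filter lemmas over [R[i]] are real. *)
Lemma gt0_complexE (e : R[i]) : 0 < e -> exists2 r : R, 0 < r & e = r%:C.
Proof.
case: e => r s; rewrite ltcE /= => /andP[/eqP -> r0]; by exists r.
Qed.

(** Replaces the filter limit of difference quotients by real estimates without division, the form
    used by Goursat's bisection and by Liouville's theorem. *)
Lemma entireP f : entire f <-> forall z, exists d, cdiff f z d.
Proof.
split=> [ef z|H z].
- have := ef z; rewrite /derivable.
  move/cvg_ex => /= [l Hl]; exists l => e e0.
  move/cvgrPdist_le : Hl => /(_ e%:C); rewrite ltcR => /(_ e0).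
  rewrite near_withinE => /nbhs_normP[r' /= /gt0_complexE [r r0 ->] Hr].
  exists r => // h hr.
  have [->|h0] := eqVneq h 0; first by rewrite addr0 subrr mulr0 subrr normc0 mulr0.
  have := Hr h; rewrite /= sub0r normrN complex_normE ltcR => /(_ hr h0).
  move=> H; rewrite -lecR rmorphM /= -!complex_normE.
  have -> : f (z + h) - f z - l * h = - (l - h^-1 * (f (h * 1 + z) - f z)) * h.
    by rewrite mulr1 [h + z]addrC mulNr mulrBl mulrAC mulVf // mul1r opprB.
  by rewrite normrM normrN ler_wpM2r.
- have [d Hd] := H z; apply/cvg_ex; exists d; apply/cvgrPdist_le => /= e' /gt0_complexE[e e0 ->].
  have [r r0 Hr] := Hd e e0.
  rewrite near_withinE; apply/nbhs_normP; exists r%:C => /=; first by rewrite ltcR.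
  move=> h; rewrite /= sub0r normrN complex_normE ltcR => /Hr hr h0.
  move: hr; rewrite -lecR rmorphM /= -!complex_normE => hr.
  have -> : d - h^-1 *: (f (h *: 1 + z) - f z) = - (f (z + h) - f z - d * h) / h.
    rewrite /GRing.scale /= mulr1 [h + z]addrC mulNr mulrBl mulfK // opprB.
    by rewrite [h^-1 * _]mulrC.
  by rewrite normrM normrN normfV ler_pdivrMr // normr_gt0.
Qed.

Lemma entireM f g : entire f -> entire g -> entire (fun z => f z * g z).
Proof. by move=> ef eg z; apply: (@derivableM R[i] (Cn R) f g z 1); [exact: ef|exact: eg]. Qed.

Lemma entireD f g : entire f -> entire g -> entire (fun z => f z + g z).
Proof. by move=> ef eg z; apply: (@derivableD R[i] (Cn R) (Cn R) f g z 1); [exact: ef|exact: eg]. Qed.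

Lemma entire_comp f g : entire f -> entire g -> entire (fun z => f (g z)).
Proof.
move=> ef eg z; apply/(@derivable1_diffP R[i] (Cn R)).
apply: (@differentiable_comp R[i] (Cn R) (Cn R) (Cn R) g f z).
  by apply/(@derivable1_diffP R[i] (Cn R)); exact: eg.
by apply/(@derivable1_diffP R[i] (Cn R)); exact: ef.
Qed.

Lemma entire_cst d : entire (fun=> d).
Proof. by move=> z; exact: derivable_cst. Qed.

Lemma entire_id : entire (fun z => z).
Proof. by move=> z; exact: derivable_id. Qed.

(** Schwarz reflection. It makes products of [f] with a conjugated [g] accessible to Cauchy
    theory. *)
Lemma entire_conj f : entire f -> entire (fun z => (f z^*)^*).
Proof.
move/entireP => H; apply/entireP => z; have [d Hd] := H z^*; exists d^* => e e0.
have normcJ u : normc (u^*) = normc u by case: u => a b /=; rewrite sqrrN.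
have [r r0 Hr] := Hd e e0; exists r => // h hr.
have := Hr h^*; rewrite normcJ => /(_ hr); rewrite -normcJ -rmorphD.
by rewrite !rmorphB /= rmorphM /= conjcK.
Qed.

End ComplexDerivative.

(** * The exponential series: Euler's formula, Taylor remainder, entireness *)

Section ComplexExponential.
Context {R : realType}.
Implicit Types (z w : R[i]).

(** Euler's formula, used as a bridge: the addition law, the period and the modulus come from the
    real [expR], [cos] and [sin], and [expCE] transfers them to the series. *)
Definition cexp z : R[i] :=
  (expR (complex.Re z) * cos (complex.Im z)) +i* (expR (complex.Re z) * sin (complex.Im z)).

Lemma cexpD z w : cexp (z + w) = cexp z * cexp w.
Proof.
case: z => a b; case: w => c d; rewrite /cexp /= expRD cosD sinD.
by apply/eqP; rewrite eq_complex /=; apply/andP; split; apply/eqP; ring.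
Qed.

Lemma cexp0 : cexp 0 = 1.
Proof. by rewrite /cexp /= expR0 cos0 sin0 mulr0 mulr1. Qed.

(** Real part of the first [n] terms of the Taylor series of e^(t z), seen as a polynomial in the
    real variable [t] so that the real mean value theorem applies on [0, 1]. *)
Definition texp_Re z n (t : R) : R := \sum_(0 <= k < n) t ^+ k * complex.Re (z ^+ k / k`!%:R).
Definition texp_Im z n (t : R) : R := \sum_(0 <= k < n) t ^+ k * complex.Im (z ^+ k / k`!%:R).

Lemma Re_mulr z w : complex.Re (z * w) = complex.Re z * complex.Re w - complex.Im z * complex.Im w.
Proof. by case: z; case: w. Qed.
Lemma Im_mulr z w : complex.Im (z * w) = complex.Re z * complex.Im w + complex.Im z * complex.Re w.
Proof. by case: z => a b; case: w => c d /=. Qed.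

Lemma texp_rec z n : z ^+ n.+1 / (n.+1)`!%:R = (n.+1%:R^-1 : R)%:C * (z * (z ^+ n / n`!%:R)).
Proof.
rewrite exprS factS natrM invfM [_%:C]fmorphV rmorph_nat.
move: (_^-1) (_^-1) => u v; ring.
Qed.

Lemma is_derive_powerM n (c t : R) :
  is_derive t (1 : R) (fun s : R => s ^+ n.+1 * c) (n.+1%:R * t ^+ n * c).
Proof.
have -> : (fun s : R => s ^+ n.+1 * c) = (c \*: ((@idfun R) ^+ n.+1)).
  by apply/funext => s /=; rewrite exprfctE mulrC.
by apply: is_derive_eq; rewrite /GRing.scale /=; ring.
Qed.

(** Componentwise form of P_(n+1)' = z P_n for the Taylor polynomials of e^(t z): the derivative of
    a remainder is z times the previous remainder. *)
Lemma is_derive_texp z n (t : R) :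
  is_derive t (1 : R) (texp_Re z n.+1)
    (complex.Re z * texp_Re z n t - complex.Im z * texp_Im z n t) /\
  is_derive t (1 : R) (texp_Im z n.+1)
    (complex.Re z * texp_Im z n t + complex.Im z * texp_Re z n t).
Proof.
elim: n => [|n [IH1 IH2]].
  rewrite /texp_Re /texp_Im !(big_geq (leqnn 0)) !mulr0 subr0 addr0.
  have E (h : R[i] -> R) : (fun s : R => \sum_(0 <= k < 1) s ^+ k * h (z ^+ k / k`!%:R)) = cst (h (z ^+ 0 / 0`!%:R)).
    by apply/funext => s; rewrite big_nat1 expr0 mul1r.
  by rewrite !E; split; exact: is_derive_cst.
have ReS (h : R[i] -> R) m s : \sum_(0 <= k < m.+1) s ^+ k * h (z ^+ k / k`!%:R) =
   \sum_(0 <= k < m) s ^+ k * h (z ^+ k / k`!%:R) + s ^+ m * h (z ^+ m / m`!%:R).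
  by rewrite big_nat_recr.
have -> : texp_Re z n.+2 = texp_Re z n.+1 + (fun s => s ^+ n.+1 * complex.Re (z ^+ n.+1 / n.+1`!%:R)).
  by apply/funext => s; rewrite /texp_Re ReS.
have -> : texp_Im z n.+2 = texp_Im z n.+1 + (fun s => s ^+ n.+1 * complex.Im (z ^+ n.+1 / n.+1`!%:R)).
  by apply/funext => s; rewrite /texp_Im ReS.
have D := is_derive_powerM.
have n0 : n.+1%:R != 0 :> R by rewrite pnatr_eq0.
rewrite texp_rec; set u := z ^+ n / n`!%:R.
have -> : complex.Re ((n.+1%:R^-1 : R)%:C * (z * u)) = n.+1%:R^-1 * (complex.Re z * complex.Re u - complex.Im z * complex.Im u).
  by rewrite !Re_mulr /= mul0r subr0.
have -> : complex.Im ((n.+1%:R^-1 : R)%:C * (z * u)) = n.+1%:R^-1 * (complex.Re z * complex.Im u + complex.Im z * complex.Re u).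
  by rewrite !Im_mulr /= mul0r addr0.
have -> : texp_Re z n.+1 t = texp_Re z n t + t ^+ n * complex.Re u by exact: ReS.
have -> : texp_Im z n.+1 t = texp_Im z n t + t ^+ n * complex.Im u by exact: ReS.
by split; apply: is_derive_eq; field.
Qed.

Lemma texp0 z n : texp_Re z n.+1 0 = 1 /\ texp_Im z n.+1 0 = 0.
Proof.
rewrite /texp_Re /texp_Im; split; rewrite big_nat_recl // expr0 mul1r expr0 fact0 divr1 /=;
  by rewrite big1 ?addr0 // => k _; rewrite exprS !mul0r.
Qed.

(* Integrated form of the induction step in the Taylor remainder estimate. *)
Lemma le_power_fact (f df : R -> R) n (K t : R) : 0 <= t ->
  f 0 = 0 -> (forall s, is_derive s (1 : R) f (df s)) ->
  (forall s, 0 <= s <= t -> df s <= K * s ^+ n / n`!%:R) ->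
  f t <= K * t ^+ n.+1 / n.+1`!%:R.
Proof.
move=> t0 f0 Df bf.
have n0 : n.+1%:R != 0 :> R by rewrite pnatr_eq0.
have n1 : n`!%:R != 0 :> R by rewrite pnatr_eq0 -lt0n fact_gt0.
have D s : is_derive s (1 : R) (fun s : R => K * s ^+ n.+1 / n.+1`!%:R - f s) (K * s ^+ n / n`!%:R - df s).
  have -> : (fun s : R => K * s ^+ n.+1 / n.+1`!%:R - f s) = (fun s : R => s ^+ n.+1 * (K / n.+1`!%:R)) - f.
    by apply/funext => u; rewrite fctE mulrA [K * _]mulrC.
  have Dfs := Df s; have Dp := is_derive_powerM n (K / n.+1`!%:R) s.
  apply: is_derive_eq; rewrite factS natrM; field.
  by apply/andP.
have [|c /itvP cI] := @MVT_segment R _ _ 0 t t0 (fun x _ => D x).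
  apply: continuous_subspaceT => x; apply: differentiable_continuous.
  by apply/derivable1_diffP; apply: (@ex_derive _ _ _ _ _ _ _ (D x)).
rewrite f0 expr0n mulr0 mul0r !subr0 => E.
rewrite -subr_ge0 E mulr_ge0 // subr_ge0; apply: bf.
by rewrite !cI.
Qed.

Lemma is_derive_cexp z t :
  is_derive t (1 : R) (fun t => expR (t * complex.Re z) * cos (t * complex.Im z))
    (complex.Re z * (expR (t * complex.Re z) * cos (t * complex.Im z))
     - complex.Im z * (expR (t * complex.Re z) * sin (t * complex.Im z))) /\
  is_derive t (1 : R) (fun t => expR (t * complex.Re z) * sin (t * complex.Im z))
    (complex.Re z * (expR (t * complex.Re z) * sin (t * complex.Im z))
     + complex.Im z * (expR (t * complex.Re z) * cos (t * complex.Im z))).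
Proof.
have D (c : R) : is_derive t (1 : R) (fun t => t * c) c.
  have -> : (fun s : R => s * c) = (c \*: id) by apply/funext => s /=; rewrite mulrC.
  by apply: is_derive_eq; rewrite /GRing.scale /= mulr1.
have De (c : R) : is_derive t (1 : R) (fun t => expR (t * c)) (c * expR (t * c)).
  by have := @is_derive1_comp R expR (fun t => t * c) t _ _ (is_derive_expR _) (D c); rewrite mulrC.
have Dc (c : R) : is_derive t (1 : R) (fun t => cos (t * c)) (- sin (t * c) * c).
  exact: (@is_derive1_comp R cos (fun t => t * c) t _ _ (is_derive_cos _) (D c)).
have Ds (c : R) : is_derive t (1 : R) (fun t => sin (t * c)) (cos (t * c) * c).
  exact: (@is_derive1_comp R sin (fun t => t * c) t _ _ (is_derive_sin _) (D c)).
split.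
  have -> : (fun t => expR (t * complex.Re z) * cos (t * complex.Im z)) =
    (fun t => expR (t * complex.Re z)) * (fun t => cos (t * complex.Im z)) by [].
  by apply: is_derive_eq; rewrite /GRing.scale /=; ring.
have -> : (fun t => expR (t * complex.Re z) * sin (t * complex.Im z)) =
    (fun t => expR (t * complex.Re z)) * (fun t => sin (t * complex.Im z)) by [].
by apply: is_derive_eq; rewrite /GRing.scale /=; ring.
Qed.

(** [expR] of |Re z| bounds e^(t z) for t in [0, 1]; each differentiation of the remainder costs one
    factor |Re z| + |Im z|. *)
Let bnd z n (t : R) := (expR `|complex.Re z| * (`|complex.Re z| + `|complex.Im z|) ^+ n) * t ^+ n / n`!%:R.

Lemma taylor_cexp z n (t : R) : 0 <= t <= 1 ->
  `|expR (t * complex.Re z) * cos (t * complex.Im z) - texp_Re z n t| <= bnd z n t /\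
  `|expR (t * complex.Re z) * sin (t * complex.Im z) - texp_Im z n t| <= bnd z n t.
Proof.
elim: n t => [|n IH] t /andP[t0 t1].
  rewrite /bnd /texp_Re /texp_Im !big_geq // !subr0 !expr0 !mulr1 fact0 divr1.
  have e0 : expR (t * complex.Re z) <= expR `|complex.Re z|.
    rewrite ler_expR; apply: (le_trans (ler_norm _)); rewrite normrM ger0_norm //.
    by rewrite ler_piMl.
  have cl (c : R) : `|c| <= 1 -> `|expR (t * complex.Re z) * c| <= expR `|complex.Re z|.
    move=> c1; rewrite normrM ger0_norm ?expR_ge0 //; apply: le_trans e0.
    by rewrite ler_piMr ?expR_ge0.
  split; apply: cl; rewrite ler_norml.
    by rewrite cos_geN1 cos_le1.
  by rewrite sin_geN1 sin_le1.
set C := expR `|complex.Re z|; set m := `|complex.Re z| + `|complex.Im z|.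
have bm (a b : R) s : `|a| <= bnd z n s -> `|b| <= bnd z n s ->
   `|complex.Re z * a + complex.Im z * b| <= (C * m ^+ n.+1) * s ^+ n / n`!%:R.
  move=> Ha Hb; apply: (le_trans (ler_normD _ _)); rewrite !normrM.
  have -> : C * m ^+ n.+1 * s ^+ n / n`!%:R = `|complex.Re z| * bnd z n s + `|complex.Im z| * bnd z n s.
    by rewrite /bnd -/C -/m -mulrDl -/m exprS; ring.
  by apply: lerD; apply: ler_wpM2l.
(* [le_power_fact] is one-sided, so it is applied to [f - g] and to its opposite. *)
have key (f g df : R -> R) : f 0 = g 0 ->
   (forall s, is_derive s (1 : R) (f - g) (df s)) ->
   (forall s, 0 <= s <= t -> `|df s| <= (C * m ^+ n.+1) * s ^+ n / n`!%:R) ->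
   `|f t - g t| <= bnd z n.+1 t.
  move=> fg0 D B; rewrite ler_norml; apply/andP; split.
    rewrite lerNl; apply: (@le_power_fact (- (f - g)) (fun s => - df s)) => //.
      by rewrite !fctE fg0 subrr oppr0.
    move=> s sI; apply: le_trans (B s sI); by rewrite -normrN ler_norm.
  apply: (@le_power_fact (f - g) df) => //.
    by rewrite !fctE fg0 subrr.
  by move=> s sI; apply: le_trans (B s sI); rewrite ler_norm.
have s1 s : 0 <= s <= t -> 0 <= s <= 1 by move=> /andP[-> /le_trans ->].
split.
  apply: (key (fun t => expR (t * complex.Re z) * cos (t * complex.Im z)) (texp_Re z n.+1) (fun s => complex.Re z * (expR (s * complex.Re z) * cos (s * complex.Im z) - texp_Re z n s)
     + complex.Im z * - (expR (s * complex.Re z) * sin (s * complex.Im z) - texp_Im z n s))).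
  - by rewrite !mul0r expR0 cos0 mul1r (texp0 _ _).1.
  - move=> s; have [D1 _] := is_derive_cexp z s; have [D2 _] := is_derive_texp z n s.
    by apply: is_derive_eq; ring.
  - by move=> s sI; have [B1 B2] := IH s (s1 s sI); apply: bm => //; rewrite normrN.
apply: (key (fun t => expR (t * complex.Re z) * sin (t * complex.Im z)) (texp_Im z n.+1) (fun s => complex.Re z * (expR (s * complex.Re z) * sin (s * complex.Im z) - texp_Im z n s)
     + complex.Im z * (expR (s * complex.Re z) * cos (s * complex.Im z) - texp_Re z n s))).
- by rewrite !mul0r expR0 sin0 mul1r (texp0 _ _).2.
- move=> s; have [_ D1] := is_derive_cexp z s; have [_ D2] := is_derive_texp z n s.
  by apply: is_derive_eq; ring.
- by move=> s sI; have [B1 B2] := IH s (s1 s sI); apply: bm.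
Qed.

Lemma normc_le z : normc z <= `|complex.Re z| + `|complex.Im z|.
Proof.
have -> : z = (complex.Re z)%:C + (0 +i* complex.Im z) by case: z => a b; rewrite /GRing.add /= addr0 add0r.
apply: le_trans (le_normcD _ _) _ => /=.
by rewrite !expr0n /= !addr0 !add0r !sqrtr_sqr.
Qed.

Lemma le_Re_normc z : `|complex.Re z| <= normc z.
Proof. by case: z => a b /=; rewrite -sqrtr_sqr ler_wsqrtr // lerDl sqr_ge0. Qed.
Lemma le_Im_normc z : `|complex.Im z| <= normc z.
Proof. by case: z => a b /=; rewrite -sqrtr_sqr ler_wsqrtr // lerDr sqr_ge0. Qed.

(** The case t = 1 of [taylor_cexp]: [2 * normc z] dominates |Re z| + |Im z|, and the final factor 2
    adds the two components. *)
Lemma cexp_remainder z n :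
  normc (cexp z - \sum_(0 <= k < n) z ^+ k / k`!%:R) <= expR (normc z) * (2 * normc z) ^+ n / n`!%:R * 2.
Proof.
have [] := @taylor_cexp z n 1; first by rewrite ler01 lexx.
rewrite !mul1r /bnd expr1n mulr1 /texp_Re /texp_Im.
under eq_bigr do rewrite expr1n mul1r.
under [in X in _ -> X -> _]eq_bigr do rewrite expr1n mul1r.
rewrite -!raddf_sum => H1 H2; apply: le_trans (normc_le _) _.
rewrite mulrDr mulr1 !raddfB /=.
have B : expR `|complex.Re z| * (`|complex.Re z| + `|complex.Im z|) ^+ n / n`!%:R <=
   expR (normc z) * (2 * normc z) ^+ n / n`!%:R.
  rewrite ler_wpM2r ?invr_ge0 ?ler0n // ler_pM ?expR_ge0 ?exprn_ge0 ?addr_ge0 //.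
    by rewrite ler_expR le_Re_normc.
  rewrite lerXn2r ?nnegrE ?addr_ge0 ?mulr_ge0 //.
    by apply: le_trans (normr_ge0 _) (le_Re_normc _).
  by rewrite mulrDl !mul1r lerD ?le_Re_normc ?le_Im_normc.
by apply: lerD; [apply: le_trans H1 B|apply: le_trans H2 B].
Qed.

(** The remainder is a constant times [exp_coeff (2 * normc z) n], the general term of a convergent
    series, hence tends to 0. *)
Lemma expCE z : expC z = cexp z.
Proof.
rewrite /expC; apply: (@cvg_lim (Cn R)); first exact: norm_hausdorff.
apply/cvgrPdist_le => /= e' /gt0_complexE[e e0 ->].
have C0 : (fun n => expR (normc z) * 2 * exp_coeff (2 * normc z) n) @ \oo --> (0 : R).
  rewrite -(mulr0 (expR (normc z) * 2)); apply: cvgMr.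
  exact: (cvg_series_cvg_0 (is_cvg_series_exp_coeff _)).
move/cvgrPdist_le : C0 => /(_ e e0); apply: filterS => n.
rewrite sub0r normrN complex_normE lecR => H; apply: le_trans (cexp_remainder z n) _.
apply: le_trans H; apply: le_trans (ler_norm _); rewrite /exp_coeff /=.
by rewrite -!mulrA; apply: ler_wpM2l; rewrite ?expR_ge0 // mulrA mulrC.
Qed.

Lemma entire_expC : entire (@expC R).
Proof.
apply/entireP => z; exists (cexp z) => e e0.
(* For |h| < 1 the remainder after two terms is at most 4 e |h|^2; the summand 1 gives [0 < M] at
   once. *)
pose M := expR 1 * 4 * normc (cexp z) + 1.
have nc0 (w : R[i]) : 0 <= normc w by apply: le_trans (normr_ge0 _) (le_Re_normc _).
have M0 : 0 < M by rewrite ltr_wpDl // !mulr_ge0 ?expR_ge0.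
exists (Num.min 1 (e / M)) => [|h]; first by rewrite lt_min ltr01 divr_gt0.
rewrite lt_min => /andP[h1 hM]; rewrite !expCE cexpD.
have -> : cexp z * cexp h - cexp z - cexp z * h = cexp z * (cexp h - \sum_(0 <= k < 2) h ^+ k / k`!%:R).
  rewrite big_nat_recr // big_nat1 /= expr0 expr1 !divr1 mulrBr mulrDr mulr1; ring.
rewrite normcM; apply: le_trans (ler_wpM2l (nc0 _) (cexp_remainder h 2)) _.
have E1 : expR (normc h) <= expR 1 by rewrite ler_expR ltW.
apply: (@le_trans _ _ ((expR 1 * 4 * normc (cexp z)) * normc h * normc h)).
  rewrite [leRHS](_ : _ = normc (cexp z) * (expR 1 * (2 * normc h) ^+ 2 / 2`!%:R * 2)); last first.
    rewrite (_ : 2`!%N = 2%N) //. by field.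
  rewrite ler_wpM2l // ler_wpM2r // ler_wpM2r ?invr_ge0 ?ler0n // ler_wpM2r //.
  by rewrite exprn_ge0 // mulr_ge0.
rewrite ler_wpM2r //; apply: (@le_trans _ _ (M * normc h)).
  by rewrite ler_wpM2r // lerDl.
by rewrite mulrC -ler_pdivlMr // ltW.
Qed.

Lemma expCD z w : expC (z + w) = expC z * expC w.
Proof. by rewrite !expCE cexpD. Qed.
Lemma expC0 : expC 0 = 1 :> R[i].
Proof. by rewrite expCE cexp0. Qed.
Lemma abs2_expC z : abs2 (expC z) = expR (2 * complex.Re z).
Proof.
rewrite expCE /abs2 /= !exprMn -mulrDr cos2Dsin2 mulr1 -expRM_natl.
by [].
Qed.
Lemma expC_conj z : expC z^* = (expC z)^*.
Proof. by rewrite !expCE; case: z => a b; rewrite /cexp /= cosN sinN mulrN. Qed.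

End ComplexExponential.

(** * Integrals of continuous real functions over segments *)

Section SegmentIntegral.
Context {R : realType}.
Notation mu := (@lebesgue_measure R).

Definition segint (c d : R) (f : R -> R) : R := Rintegral mu `[c, d] f.

Lemma segint_integrable (c d : R) (f : R -> R) : continuous f -> mu.-integrable `[c, d] (EFin \o f).
Proof.
move=> cf; apply: continuous_compact_integrable; first exact: segment_compact.
by apply: continuous_subspaceT => x; exact: cf.
Qed.

Lemma segint_split (c m d : R) (f : R -> R) : continuous f -> c <= m -> m <= d -> segint c d f = segint c m f + segint m d f.
Proof.
move=> cf cm md; rewrite /segint.
have I := segint_integrable c d f cf.
have := @Rintegral_itvB R f (BLeft c) (BRight d) m I; rewrite !bnd_simp => /(_ cm md) E.
(* The subtraction lemma leaves the half-open interval from [m] to [d]; its missing endpoint is a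
   null set. *)
rewrite -(@Rintegral_itv_obnd_cbnd _ m (BRight d) f); first by rewrite -E addrC subrK.
apply: integrableS I => //.
by apply: subset_itv; rewrite bnd_simp.
Qed.

Lemma segint_sub (c d : R) (f g : R -> R) : continuous f -> continuous g ->
  segint c d (fun x => f x - g x) = segint c d f - segint c d g.
Proof. by move=> cf cg; rewrite /segint RintegralB //; exact: segint_integrable. Qed.

Lemma segint_scale (c d k : R) (f : R -> R) : continuous f ->
  segint c d (fun x => k * f x) = k * segint c d f.
Proof. by move=> cf; rewrite /segint RintegralZl //; exact: segint_integrable. Qed.

Lemma segint_cst (c d k : R) : c <= d -> segint c d (fun=> k) = k * (d - c).
Proof.
move=> cd; rewrite /segint Rintegral_cst //=; congr (_ * _).
by rewrite lebesgue_measure_itv /= lte_fin; case: ltgtP cd => //= ->; rewrite subrr.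
Qed.

(** Serves twice: for the linear approximation in Goursat's theorem, and in [segint_limit] for
    functions uniformly close to a constant. *)
Lemma segint_bound (c d : R) (f : R -> R) (k M : R) : c <= d -> continuous f ->
  (forall x, c <= x <= d -> `|f x - k| <= M) -> `|segint c d f - k * (d - c)| <= M * (d - c).
Proof.
move=> cd cf fM.
have ck (k' : R) : continuous (fun _ : R => k') by exact: cst_continuous.
have cfk : continuous (fun x => f x - k) by move=> x; apply: cvgB; [exact: cf|exact: cst_continuous].
have cn : continuous (fun x => `|f x - k|).
  by move=> x; apply: cvg_norm; exact: cfk.
rewrite -segint_cst // -segint_sub // -segint_cst // /segint.
apply: le_trans (le_normr_Rintegral _ _) _ => //; first exact: segint_integrable cfk.
apply: le_Rintegral => //.
- exact: segint_integrable cn.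
- exact: segint_integrable (ck M).
Qed.

End SegmentIntegral.

(* [W] is an additive function of rectangles that is locally negligible with
   respect to the squared diameter; Goursat's bisection shows it vanishes. *)
Section Bisection.
Context {R : realType}.
Variable W : R -> R -> R -> R -> R.
Hypothesis Wx : forall a m b c d, a <= m -> m <= b -> c <= d -> W a b c d = W a m c d + W m b c d.
Hypothesis Wy : forall a b c n d, a <= b -> c <= n -> n <= d -> W a b c d = W a b c n + W a b n d.
Hypothesis Wloc : forall x y e, 0 < e -> exists2 r, 0 < r &
  forall a b c d, a <= x -> x <= b -> c <= y -> y <= d -> b - a < r -> d - c < r ->
    `|W a b c d| <= e * (b - a + (d - c)) ^+ 2.

(** [W] is the sum of its values on the four quarters, so one of them carries at least a quarter of
    the modulus. The witness [q] is the pair of its two side intervals. *)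
Lemma rectangle_quarter a b c d : a <= b -> c <= d -> exists q : (R * R) * (R * R),
  [/\ a <= q.1.1, q.1.2 <= b, c <= q.2.1 & q.2.2 <= d] /\
  [/\ q.1.2 - q.1.1 = (b - a) / 2, q.2.2 - q.2.1 = (d - c) / 2 &
   `|W a b c d| <= 4 * `|W q.1.1 q.1.2 q.2.1 q.2.2|].
Proof.
move=> ab cd; set m := (a + b) / 2; set n := (c + d) / 2.
have am : a <= m by rewrite /m; lra.
have mb : m <= b by rewrite /m; lra.
have cn : c <= n by rewrite /n; lra.
have nd : n <= d by rewrite /n; lra.
have E : W a b c d = W a m c n + W a m n d + (W m b c n + W m b n d).
  by rewrite (Wx a m b) // (Wy a m c n d) // (Wy m b c n d).
have T : `|W a b c d| <= `|W a m c n| + `|W a m n d| + (`|W m b c n| + `|W m b n d|).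
  by rewrite E; apply: (le_trans (ler_normD _ _)); apply: lerD; exact: ler_normD.
have [H1|H1] := lerP `|W a b c d| (4 * `|W a m c n|).
  by exists ((a, m), (c, n)); split; split => //=; rewrite /m /n; lra.
have [H2|H2] := lerP `|W a b c d| (4 * `|W a m n d|).
  by exists ((a, m), (n, d)); split; split => //=; rewrite /m /n; lra.
have [H3|H3] := lerP `|W a b c d| (4 * `|W m b c n|).
  by exists ((m, b), (c, n)); split; split => //=; rewrite /m /n; lra.
(* The other three quarters each carry less than a quarter, so [T] forces the bound on this one. *)
by exists ((m, b), (n, d)); split; split => //=; rewrite /m /n; lra.
Qed.

Lemma bisection0 a b c d : a <= b -> c <= d -> W a b c d = 0.
Proof.
move=> ab cd.
pose S := {q : (R * R) * (R * R) | q.1.1 <= q.1.2 /\ q.2.1 <= q.2.2}.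
(* A chosen quarter as a function on well-oriented rectangles, so that the bisection is a plain
   [iter]. *)
have step (q : S) : {q' : S |
  [/\ (sval q).1.1 <= (sval q').1.1, (sval q').1.2 <= (sval q).1.2,
      (sval q).2.1 <= (sval q').2.1 & (sval q').2.2 <= (sval q).2.2] /\
  [/\ (sval q').1.2 - (sval q').1.1 = ((sval q).1.2 - (sval q).1.1) / 2,
      (sval q').2.2 - (sval q').2.1 = ((sval q).2.2 - (sval q).2.1) / 2 &
   `|W (sval q).1.1 (sval q).1.2 (sval q).2.1 (sval q).2.2| <=
     4 * `|W (sval q').1.1 (sval q').1.2 (sval q').2.1 (sval q').2.2|]}.
  apply: cid; case: q => [[[a' b'] [c' d']] /= [ab' cd']].
  have [q [H1 [E1 E2 H2]]] := rectangle_quarter a' b' c' d' ab' cd'.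
  have P : q.1.1 <= q.1.2 /\ q.2.1 <= q.2.2.
    by rewrite -subr_ge0 E1 -(subr_ge0 q.2.1) E2; split; apply: divr_ge0; rewrite ?subr_ge0.
  by exists (exist _ q P).
pose q0 : S := exist (fun q : (R * R) * (R * R) => q.1.1 <= q.1.2 /\ q.2.1 <= q.2.2) ((a, b), (c, d)) (conj ab cd).
pose Q n := iter n (fun q => sval (step q)) q0.
have QS n : Q n.+1 = sval (step (Q n)) by [].
pose A n := (sval (Q n)).1.1; pose B n := (sval (Q n)).1.2.
pose C n := (sval (Q n)).2.1; pose D n := (sval (Q n)).2.2.
have AB n : A n <= B n by exact: (svalP (Q n)).1.
have CD n : C n <= D n by exact: (svalP (Q n)).2.
have len n : B n - A n = (b - a) / 2 ^+ n /\ D n - C n = (d - c) / 2 ^+ n.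
  elim: n => [|n [IH1 IH2]]; first by rewrite expr0 !divr1.
  have [_ [E1 E2 _]] := svalP (step (Q n)).
  rewrite /A /B /C /D QS E1 E2 -/(A n) -/(B n) -/(C n) -/(D n) IH1 IH2 exprSr invfM !mulrA.
  by [].
have WQ n : `|W a b c d| <= 4 ^+ n * `|W (A n) (B n) (C n) (D n)|.
  elim: n => [|n IH]; first by rewrite expr0 mul1r.
  have [_ [_ _ H]] := svalP (step (Q n)).
  by rewrite exprSr -mulrA; apply: (le_trans IH); rewrite ler_wpM2l // exprn_ge0.
(* The common point is the supremum of the left endpoints. *)
have nested (f g : nat -> R) : (forall n, f n <= g n) ->
    (forall n, f n <= f n.+1) -> (forall n, g n.+1 <= g n) ->
    exists x, forall n, f n <= x /\ x <= g n.
  move=> fg fS gS.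
  have fm m n : (m <= n)%N -> f m <= f n by apply: (@homo_leq _ f <=%O) => //; exact: le_trans.
  have gm m n : (m <= n)%N -> g n <= g m.
    apply: (@homo_leq _ g (fun x y => y <= x)) => //.
    by move=> x y z yx zx; exact: le_trans zx yx.
  have fg' m n : f m <= g n.
    apply: le_trans (fm _ _ (leq_maxl m n)) (le_trans (fg _) (gm _ _ (leq_maxr m n))).
  exists (sup (range f)) => n; split.
    apply: ub_le_sup; last by exists n.
    by exists (g 0%N) => _ [m _ <-].
  by apply: ge_sup; [exists (f 0%N); exists 0%N|move=> _ [m _ <-]].
have [x xP] : exists x, forall n, A n <= x /\ x <= B n.
  apply: nested => // n; have [[H1 H2 H3 H4] _] := svalP (step (Q n)); rewrite /A /B QS //.
have [y yP] : exists x, forall n, C n <= x /\ x <= D n.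
  apply: nested => // n; have [[H1 H2 H3 H4] _] := svalP (step (Q n)); rewrite /C /D QS //.
set s := b - a + (d - c).
have s0 : 0 <= s by rewrite addr_ge0 ?subr_ge0.
(* After n halvings the loss 4^n is exactly compensated by the squared size (s / 2^n)^2; n is taken
   so large that both sides are below the radius given by [Wloc]. *)
have H e : 0 < e -> `|W a b c d| <= e * s ^+ 2.
  move=> e0; have [r r0 Hr] := Wloc x y e e0.
  have [n Hn] : exists n, s < r * 2 ^+ n.
    have : (fun n => s * (2^-1) ^+ n) @ \oo --> (0 : R).
      rewrite -(mulr0 s); apply: cvgMr; apply: cvg_expr.
      by rewrite ger0_norm ?invr_ge0 // invf_lt1 // ltr1n.
    move/cvgrPdist_lt => /(_ r r0) [n _ /(_ n (leqnn n))] /=.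
    rewrite sub0r normrN => H; exists n; rewrite -ltr_pdivrMr ?exprn_gt0 //.
    by rewrite -exprVn; apply: le_lt_trans (ler_norm _) H.
  have p0 : 0 < 2 ^+ n :> R by rewrite exprn_gt0.
  have [L1 L2] := len n.
  have [x1 x2] := xP n; have [y1 y2] := yP n.
  have := Hr _ _ _ _ x1 x2 y1 y2; rewrite L1 L2 !ltr_pdivrMr // => /(_ _ _)/wrap[].
    by apply: le_lt_trans Hn; rewrite /s lerDl subr_ge0.
    by apply: le_lt_trans Hn; rewrite /s lerDr subr_ge0.
  move=> HW; apply: le_trans (WQ n) _.
  have := ler_wpM2l (ltW (exprn_gt0 n (ltr0n R 4))) HW; move/le_trans; apply.
  rewrite le_eqVlt; apply/orP; left; apply/eqP.
  rewrite -mulrDl -/s (_ : 4 = 2 ^+ 2 :> R); last by rewrite -natrX.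
  rewrite -exprM mulnC exprM; field.
  by rewrite gt_eqF.
apply/eqP; rewrite -normr_eq0 eq_le normr_ge0 andbT.
apply/ler_addgt0Pr => e e0; rewrite add0r.
(* Dividing by [s ^+ 2 + 1] also covers the degenerate rectangle [s = 0]. *)
have s1 : 0 < s ^+ 2 + 1 by rewrite ltr_wpDl ?sqr_ge0.
apply: le_trans (H (e / (s ^+ 2 + 1)) _) _; first by rewrite divr_gt0.
by rewrite mulrAC ler_pdivrMr // ler_pM2l // lerDl.
Qed.

End Bisection.

(** * Goursat's theorem, vertical means of periodic functions and the mean value property *)

Section Cauchy.
Context {R : realType}.
Implicit Types (f g H : R[i] -> R[i]) (z w u : R[i]).

Lemma normc_ge0 z : 0 <= normc z.
Proof. by apply: le_trans (normr_ge0 _) (le_Re_normc _). Qed.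

Lemma entire_eps f : entire f -> forall z e, 0 < e -> exists2 r : R, 0 < r &
  forall h, normc h < r -> normc (f (z + h) - f z) <= e.
Proof.
move=> /entireP ef z e e0; have [d /(_ 1 ltr01)[r r0 Hr]] := ef z.
have M0 : 0 < normc d + 1 by rewrite ltr_wpDl ?normc_ge0.
exists (Num.min r (e / (normc d + 1))) => [|h].
  by rewrite lt_min r0 divr_gt0.
rewrite lt_min => /andP[hr]; rewrite ltr_pdivlMr // => he.
have -> : f (z + h) - f z = (f (z + h) - f z - d * h) + d * h by rewrite subrK.
apply: le_trans (le_normcD _ _) _; rewrite normcM.
apply: le_trans (ltW he); rewrite mulrDr mulr1 addrC [normc d * _]mulrC lerD2l.
by apply: le_trans (Hr h hr) _; rewrite mul1r.
Qed.

Lemma entire_continuous_path f (p : R -> R[i]) : entire f ->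
  (forall s t, normc (p s - p t) <= `|s - t|) ->
  continuous (fun t => complex.Re (f (p t))) /\ continuous (fun t => complex.Im (f (p t))).
Proof.
move=> ef Lp.
have K (h : R[i] -> R) : (forall z w, `|h z - h w| <= normc (z - w)) -> continuous (fun t => h (f (p t))).
  move=> hL t; apply/cvgrPdist_le => e e0.
  have [r r0 Hr] := entire_eps f ef (p t) e e0.
  apply/nbhs_normP; exists r => //= s ts.
  rewrite distrC; apply: le_trans (hL _ _) _.
  have -> : p s = p t + (p s - p t) by rewrite addrC subrK.
  apply: Hr; apply: le_lt_trans (Lp _ _) _; by rewrite distrC.
split; apply: K => z w; rewrite -raddfB; [exact: le_Re_normc|exact: le_Im_normc].
Qed.

Lemma entire_continuous_vert f x : entire f ->
  continuous (fun t => complex.Re (f (x +i* t))) /\ continuous (fun t => complex.Im (f (x +i* t))).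
Proof.
move=> ef; apply: (entire_continuous_path f (fun t => x +i* t)) => // s t.
by apply: le_trans (normc_le _) _; rewrite /= subrr normr0 add0r.
Qed.

Lemma entire_continuous_horiz f y : entire f ->
  continuous (fun t => complex.Re (f (t +i* y))) /\ continuous (fun t => complex.Im (f (t +i* y))).
Proof.
move=> ef; apply: (entire_continuous_path f (fun t => t +i* y)) => // s t.
by apply: le_trans (normc_le _) _; rewrite /= subrr normr0 addr0.
Qed.

Section Goursat.
Variable H : R[i] -> R[i].
Hypothesis eH : entire H.

Let u x y := complex.Re (H (x +i* y)).
Let v x y := complex.Im (H (x +i* y)).
(** The imaginary part of the integral of H dz along the counterclockwise boundary of [a, b] x
    [c, d]. *)
Let W a b c d := segint c d (fun y => u b y - u a y) - segint a b (fun x => v x d - v x c).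

Let cu x : continuous (u x). Proof. exact: (entire_continuous_vert H x eH).1. Qed.
Let cv y : continuous (v ^~ y). Proof. exact: (entire_continuous_horiz H y eH).2. Qed.

(** For an affine H both segment integrals equal Re D times the area (the Cauchy-Riemann equations)
    and cancel. The errors of the affine approximation add up to e s (d - c) + e s (b - a) = e
    s^2. *)
Lemma rectangle_integral_local x y e : 0 < e -> exists2 r, 0 < r &
  forall a b c d, a <= x -> x <= b -> c <= y -> y <= d -> b - a < r -> d - c < r ->
    `|W a b c d| <= e * (b - a + (d - c)) ^+ 2.
Proof.
move=> e0; have /entireP /(_ (x +i* y)) [D HD] := eH.
(* Half of [e], because values at opposite edges are compared through the centre, which uses the
   approximation twice. *)
have [r r0 Hr] := HD (e / 2) (divr_gt0 e0 (ltr0n _ 2)).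
exists (r / 2) => [|a b c d ax xb cy yd bar dcr]; first by rewrite divr_gt0.
set s := b - a + (d - c).
have sr : s < r by rewrite /s; lra.
have s0 : 0 <= s by rewrite /s; lra.
have near1 x' y' : a <= x' <= b -> c <= y' <= d ->
    normc (H (x' +i* y') - H (x +i* y) - D * ((x' - x) +i* (y' - y))) <= e / 2 * s.
  move=> /andP[ax' xb'] /andP[cy' yd'].
  have hs : normc ((x' - x) +i* (y' - y)) <= s.
    apply: le_trans (normc_le _) _ => /=; apply: lerD; rewrite ler_norml; apply/andP; split; lra.
  have := Hr ((x' - x) +i* (y' - y)) (le_lt_trans hs sr).
  have -> : x +i* y + ((x' - x) +i* (y' - y)) = x' +i* y'.
    by apply/eqP; rewrite eq_complex /=; apply/andP; split; apply/eqP; ring.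
  by move/le_trans; apply; rewrite ler_wpM2l // divr_ge0 // ltW.
have near2 x1 y1 x2 y2 : a <= x1 <= b -> c <= y1 <= d -> a <= x2 <= b -> c <= y2 <= d ->
    normc (H (x2 +i* y2) - H (x1 +i* y1) - D * ((x2 - x1) +i* (y2 - y1))) <= e * s.
  move=> X1 Y1 X2 Y2.
  have -> : H (x2 +i* y2) - H (x1 +i* y1) - D * ((x2 - x1) +i* (y2 - y1)) =
    (H (x2 +i* y2) - H (x +i* y) - D * ((x2 - x) +i* (y2 - y))) +
    - (H (x1 +i* y1) - H (x +i* y) - D * ((x1 - x) +i* (y1 - y))).
    have -> : (x2 - x1) +i* (y2 - y1) = ((x2 - x) +i* (y2 - y)) - ((x1 - x) +i* (y1 - y)).
      by apply/eqP; rewrite eq_complex /=; apply/andP; split; apply/eqP; ring.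
    ring.
  apply: le_trans (le_normcD _ _) _; rewrite normcN.
  have -> : e * s = e / 2 * s + e / 2 * s by field.
  by apply: lerD; apply: near1.
have ab : a <= b by lra. have cd : c <= d by lra.
have I1 : `|segint c d (fun t => u b t - u a t) - complex.Re D * (b - a) * (d - c)| <= e * s * (d - c).
  apply: segint_bound => //.
    by move=> t; apply: cvgB; exact: cu.
  move=> t tI; have := near2 a t b t; rewrite !lexx !ab => /(_ isT tI isT tI).
  move/(le_trans (le_Re_normc _)); rewrite !raddfB /= subrr Re_mulr /= mulr0 subr0.
  by [].
have I2 : `|segint a b (fun t => v t d - v t c) - complex.Re D * (d - c) * (b - a)| <= e * s * (b - a).
  apply: segint_bound => //.
    by move=> t; apply: cvgB; exact: cv.
  move=> t tI; have := near2 t c t d; rewrite !lexx !cd => /(_ tI isT tI isT).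
  move/(le_trans (le_Im_normc _)); rewrite !raddfB /= subrr Im_mulr /= mulr0 addr0.
  by [].
have -> : W a b c d = (segint c d (fun t => u b t - u a t) - complex.Re D * (b - a) * (d - c))
   + - (segint a b (fun t => v t d - v t c) - complex.Re D * (d - c) * (b - a)).
  by rewrite /W; ring.
apply: le_trans (ler_normD _ _) _; rewrite normrN.
apply: le_trans (lerD I1 I2) _; rewrite -mulrDr -mulrA expr2 [X in s * X]addrC -/s.
by [].
Qed.

Lemma goursat_Re a b c d : a <= b -> c <= d ->
  segint c d (fun y => complex.Re (H (b +i* y)) - complex.Re (H (a +i* y))) =
  segint a b (fun x => complex.Im (H (x +i* d)) - complex.Im (H (x +i* c))).
Proof.
move=> ab cd; apply/eqP; rewrite -subr_eq0; apply/eqP.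
apply: (bisection0 W) => //; last exact: rectangle_integral_local.
- move=> a' m b' c' d' am mb cd'.
  rewrite /W (segint_split a' m b') //; last by move=> t; apply: cvgB; exact: cv.
  rewrite !segint_sub //; ring.
- move=> a' b' c' n d' ab' cn nd.
  rewrite /W (segint_split c' n d') //; last by move=> t; apply: cvgB; exact: cu.
  rewrite !segint_sub //; ring.
Qed.

End Goursat.

Definition periodic_2pi H := forall z, H (z + (0 +i* (2 * pi))) = H z.

(** On a rectangle of height 2 pi the two horizontal edges carry the same values, so Goursat's
    theorem compares the vertical edges alone. *)
Lemma mean_vert_Re H a b : entire H -> periodic_2pi H -> a <= b ->
  segint 0 (2 * pi) (fun t => complex.Re (H (b +i* t))) =
  segint 0 (2 * pi) (fun t => complex.Re (H (a +i* t))).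
Proof.
move=> eH pH ab; have pi0 : 0 <= 2 * pi :> R by rewrite mulr_ge0 ?pi_ge0.
have := goursat_Re H eH a b 0 (2 * pi) ab pi0.
rewrite segint_sub; [|exact: (entire_continuous_vert H _ eH).1|exact: (entire_continuous_vert H _ eH).1].
have -> : (fun x => complex.Im (H (x +i* (2 * pi))) - complex.Im (H (x +i* 0))) = (fun _ : R => 0).
  apply/funext => x; rewrite -(pH (x +i* 0)).
  have -> : (x +i* 0) + (0 +i* (2 * pi)) = x +i* (2 * pi).
    by apply/eqP; rewrite eq_complex /= addr0 add0r !eqxx.
  by rewrite subrr.
by rewrite segint_cst // mul0r => /eqP; rewrite subr_eq0 => /eqP.
Qed.

Lemma entireZ (c : R[i]) {H} : entire H -> entire (fun z => c * H z).
Proof. by move=> eH; exact: (entireM (fun=> c) H (entire_cst c) eH). Qed.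

Lemma entireMr {H} (c : R[i]) : entire H -> entire (fun z => H z * c).
Proof. by move=> eH; exact: (entireM H (fun=> c) eH (entire_cst c)). Qed.

Lemma mean_vert H a b : entire H -> periodic_2pi H ->
  segint 0 (2 * pi) (fun t => complex.Re (H (b +i* t))) =
  segint 0 (2 * pi) (fun t => complex.Re (H (a +i* t))) /\
  segint 0 (2 * pi) (fun t => complex.Im (H (b +i* t))) =
  segint 0 (2 * pi) (fun t => complex.Im (H (a +i* t))).
Proof.
move=> eH pH; wlog ab : a b / a <= b.
  by move=> K; have [/K//|/ltW/K[-> ->]] := lerP a b.
split; first exact: mean_vert_Re.
(* The imaginary part of [H] is the real part of [-i H]. *)
pose G := fun z => (0 -i* 1) * H z.
have E x : (fun t => complex.Im (H (x +i* t))) = (fun t => complex.Re (G (x +i* t))).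
  by apply/funext => t; rewrite /G Re_mulr /=; ring.
have pG : periodic_2pi G by move=> z; rewrite /G pH.
have EG := mean_vert_Re G a b (entireZ _ eH) pG ab.
exact: (etrans (congr1 (segint 0 (2 * pi)) (E b)) (etrans EG (esym (congr1 (segint 0 (2 * pi)) (E a))))).
Qed.

(** As the integral does not depend on [s], a single [s] for each [e] replaces a limit under the
    integral. *)
Lemma segint_limit (F : R -> R -> R) (k m : R) : (forall s, continuous (F s)) ->
  (forall s, segint 0 (2 * pi) (F s) = m) ->
  (forall e, 0 < e -> exists s, forall t, `|F s t - k| <= e) -> m = k * (2 * pi).
Proof.
move=> cF mF kF; have pi0 : 0 < 2 * pi :> R by rewrite mulr_gt0 ?pi_gt0.
apply/eqP; rewrite -subr_eq0 -normr_eq0 eq_le normr_ge0 andbT.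
apply/ler_addgt0Pr => e e0; rewrite add0r.
have [s Hs] := kF (e / (2 * pi)) (divr_gt0 e0 pi0).
have := segint_bound 0 (2 * pi) (F s) k _ (ltW pi0) (cF s) (fun t _ => Hs t).
by rewrite mF subr0 divfK // gt_eqF.
Qed.

Lemma expC_period : periodic_2pi (@expC R).
Proof.
move=> z; rewrite expCD (_ : expC (0 +i* (2 * pi)) = 1) ?mulr1 //.
by rewrite expCE /cexp /= expR0 !mul1r [2 * pi]mulr_natl cos2pi sin2pi.
Qed.

Lemma normc_expC z : normc (expC z) = expR (complex.Re z).
Proof.
have -> : normc (expC z) = Num.sqrt (abs2 (expC z)) by case: (expC z).
by rewrite abs2_expC mulrDl mul1r expRD -expr2 sqrtr_sqr ger0_norm ?expR_ge0.
Qed.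

(* [h (e^zeta u)] is periodic in [zeta], so its mean over a vertical period does
   not depend on [Re zeta], which is sent to -oo. *)
Lemma mean_value h u : entire h ->
  segint 0 (2 * pi) (fun t => complex.Re (h (expC (0 +i* t) * u))) = complex.Re (h 0) * (2 * pi) /\
  segint 0 (2 * pi) (fun t => complex.Im (h (expC (0 +i* t) * u))) = complex.Im (h 0) * (2 * pi).
Proof.
move=> eh; pose H z := h (expC z * u).
have eH : entire H.
  exact: (entire_comp h _ eh (entireMr u entire_expC)).
have pH : periodic_2pi H by move=> z; rewrite /H expC_period.
have small e : 0 < e -> exists s, forall t, normc (H (s +i* t) - h 0) <= e.
  move=> e0; have [r r0 Hr] := entire_eps h eh 0 e e0.
  have M0 : 0 < normc u + 1 by rewrite ltr_wpDl ?normc_ge0.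
  (* With this abscissa, |e^zeta u| = r |u| / (|u| + 1) < r, also when u = 0. *)
  exists (ln (r / (normc u + 1))) => t; rewrite /H -[_ * u]add0r; apply: Hr.
  rewrite normcM normc_expC /= lnK ?posrE ?divr_gt0 //.
  by rewrite -mulrA gtr_pMr // mulrC ltr_pdivrMr // mul1r ltrDl.
split.
  apply: (segint_limit (fun s t => complex.Re (H (s +i* t)))).
  - by move=> s; exact: (entire_continuous_vert H s eH).1.
  - by move=> s; exact: (mean_vert H 0 s eH pH).1.
  - move=> e /small[s Hs]; exists s => t; rewrite -raddfB.
    exact: le_trans (le_Re_normc _) (Hs t).
apply: (segint_limit (fun s t => complex.Im (H (s +i* t)))).
- by move=> s; exact: (entire_continuous_vert H s eH).2.
- by move=> s; exact: (mean_vert H 0 s eH pH).2.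
- move=> e /small[s Hs]; exists s => t; rewrite -raddfB.
  exact: le_trans (le_Im_normc _) (Hs t).
Qed.

(* Both sides are vertical means, at [Re zeta = ln r] and [Re zeta = 0], of the
   periodic entire function [f (e^zeta u) * (g ((r / e^zeta)^* u))^*]. *)
Lemma mean_dilation f g u (r : R) : entire f -> entire g -> 0 < r ->
  let c t := expC (0 +i* t) in
  segint 0 (2 * pi) (fun t => complex.Re (f (r%:C * (c t * u)) * (g (c t * u))^*)) =
  segint 0 (2 * pi) (fun t => complex.Re (f (c t * u) * (g (r%:C * (c t * u)))^*)) /\
  segint 0 (2 * pi) (fun t => complex.Im (f (r%:C * (c t * u)) * (g (c t * u))^*)) =
  segint 0 (2 * pi) (fun t => complex.Im (f (c t * u) * (g (r%:C * (c t * u)))^*)).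
Proof.
move=> ef eg r0 c.
pose H z := f (expC z * u) * (g (expC ((ln r)%:C - z)^* * u))^*.
have eH : entire H.
  apply: (entireM (fun z => f (expC z * u)) (fun z => (g (expC ((ln r)%:C - z)^* * u))^*)).
    exact: (entire_comp f _ ef (entireMr u entire_expC)).
  (* The conjugation of the argument cancels the one around [g]: the function is the reflection of
     [g] composed with a function that is holomorphic in [z]. *)
  have -> : (fun z => (g (expC ((ln r)%:C - z)^* * u))^*) =
      (fun z => (fun w => (g w^*)^*) (expC ((ln r)%:C + (-1) * z) * u^*)).
    by apply/funext => z; rewrite rmorphM /= -expC_conj conjcK mulN1r.
  apply: (entire_comp (fun w => (g w^*)^*) _ (entire_conj g eg)).
  have ein : entire (fun z => (ln r)%:C + (-1) * z).
    exact: (entireD (fun=> _) (fun z => (-1) * z) (entire_cst _) (entireZ (-1) entire_id)).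
  have eout := entire_comp (@expC R) _ entire_expC ein.
  refine (entireMr u^* eout).
have pH : periodic_2pi H.
  move=> z; rewrite /H expC_period; set w := ((ln r)%:C - z)^*.
  have -> : ((ln r)%:C - (z + (0 +i* (2 * pi))))^* = w + (0 +i* (2 * pi)); last by rewrite expC_period.
  by rewrite /w; case: z {w} => p q; apply/eqP; rewrite eq_complex /=; apply/andP; split; apply/eqP; ring.
have er : expC (ln r)%:C = r%:C by rewrite expCE /cexp /= cos0 sin0 mulr0 mulr1 lnK ?posrE.
have E1 t : H (ln r +i* t) = f (r%:C * (c t * u)) * (g (c t * u))^*.
  rewrite /H /c; have -> : ((ln r)%:C - (ln r +i* t))^* = 0 +i* t.
    by apply/eqP; rewrite eq_complex /=; apply/andP; split; apply/eqP; ring.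
  have -> : ln r +i* t = (ln r)%:C + (0 +i* t).
    by apply/eqP; rewrite eq_complex /= addr0 add0r !eqxx.
  by rewrite expCD er mulrA.
have E2 t : H (0 +i* t) = f (c t * u) * (g (r%:C * (c t * u)))^*.
  rewrite /H /c; have -> : ((ln r)%:C - (0 +i* t))^* = (ln r)%:C + (0 +i* t).
    by apply/eqP; rewrite eq_complex /=; apply/andP; split; apply/eqP; ring.
  by rewrite expCD er mulrA.
have [M1 M2] := mean_vert H 0 (ln r) eH pH.
have T (h : R[i] -> R) : segint 0 (2 * pi) (fun t => h (H (ln r +i* t))) = segint 0 (2 * pi) (fun t => h (H (0 +i* t))) ->
    segint 0 (2 * pi) (fun t => h (f (r%:C * (c t * u)) * (g (c t * u))^*)) =
    segint 0 (2 * pi) (fun t => h (f (c t * u) * (g (r%:C * (c t * u)))^*)).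
  move=> M; have F1 := funext (fun t => congr1 h (E1 t)).
  have F2 := funext (fun t => congr1 h (E2 t)).
  exact: (etrans (esym (congr1 (segint 0 (2 * pi)) F1)) (etrans M (congr1 (segint 0 (2 * pi)) F2))).
by split; apply: T.
Qed.

End Cauchy.

(** * Liouville's theorem from vertical means *)

Section Liouville.
Context {R : realType}.
Implicit Types (h : R[i] -> R[i]) (z w : R[i]).

Lemma entireB f g : entire f -> entire g -> entire (fun z : R[i] => f z - g z).
Proof.
move=> ef eg; have -> : (fun z => f z - g z) = (fun z => f z + (-1) * g z).
  by apply/funext => z; rewrite mulN1r.
exact: (entireD f _ ef (entireZ (-1) eg)).
Qed.

(* The vertical mean of [(h (w + e^zeta) - h w) e^(-zeta)] tends to [d] as
   [Re zeta] goes to -oo and to 0 as it goes to +oo. *)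
Lemma bounded_entire_deriv0 h B w d : entire h -> (forall z, normc (h z) <= B) ->
  cdiff h w d -> d = 0.
Proof.
move=> eh hB hd.
pose H z := (h (w + expC z) - h w) * expC ((-1) * z).
have eH : entire H.
  have e1 : entire (fun z => w + expC z) := entireD (fun=> w) (@expC R) (entire_cst w) entire_expC.
  have e2 : entire (fun z => h (w + expC z) - h w) := entireB _ _ (entire_comp h _ eh e1) (entire_cst (h w)).
  have e3 := entire_comp (@expC R) _ entire_expC (entireZ (-1) entire_id).
  exact: (entireM _ _ e2 e3).
have pH : periodic_2pi H.
  move=> z; rewrite /H expC_period; set P := 0 +i* (2 * pi).
  have -> : expC ((-1) * z) = expC ((-1) * (z + P)); last by [].
  rewrite -(expC_period ((-1) * (z + P))) -/P; congr expC.
  by rewrite mulrDr mulN1r mulN1r -addrA addNr addr0.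
have B0 : 0 <= B := le_trans (normc_ge0 _) (hB 0).
have small e : 0 < e -> exists s, forall t, normc (H (s +i* t) - d) <= e.
  move=> e0; have [r r0 Hr] := hd e e0; exists (ln (r / 2)) => t; rewrite /H.
  set u := expC _; set v := expC _.
  have uv : u * v = 1 by rewrite /u /v -expCD mulN1r subrr expC0.
  have nu : normc u = r / 2 by rewrite /u normc_expC /= lnK // posrE divr_gt0.
  clearbody u v.
  have -> : (h (w + u) - h w) * v - d = (h (w + u) - h w - d * u) * v.
    by rewrite [RHS]mulrBl -[d * u * v]mulrA uv mulr1.
  rewrite normcM; have := Hr u; rewrite nu => /(_ _)/wrap[].
    by rewrite ltr_pdivrMr // ltr_pMr // ltr1n.
  move/(ler_wpM2r (normc_ge0 v))/le_trans; apply.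
  by rewrite -nu -mulrA -normcM uv normc1 mulr1.
have large e : 0 < e -> exists s, forall t, normc (H (s +i* t) - 0) <= e.
  move=> e0; have B2 : 0 < 2 * B + 1 by rewrite ltr_wpDl ?mulr_ge0.
  (* Here |e^(-zeta)| = e / (2 B + 1), while the increment of [h] is at most 2 B. *)
  exists (- ln (e / (2 * B + 1))) => t.
  rewrite subr0 /H normcM normc_expC mulN1r [complex.Re _]/= opprK.
  rewrite lnK ?posrE ?divr_gt0 //.
  rewrite mulrA ler_pdivrMr // mulrC ler_pM2l //.
  apply: le_trans (le_normcD _ _) _; rewrite normcN mulrDl !mul1r -addrA.
  by rewrite lerD // (le_trans (hB _)) // lerDl.
have [M1 M2] : (forall s, segint 0 (2 * pi) (fun t => complex.Re (H (s +i* t))) = segint 0 (2 * pi) (fun t => complex.Re (H (0 +i* t))))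
   /\ (forall s, segint 0 (2 * pi) (fun t => complex.Im (H (s +i* t))) = segint 0 (2 * pi) (fun t => complex.Im (H (0 +i* t)))).
  by split=> s; [exact: (mean_vert H 0 s eH pH).1|exact: (mean_vert H 0 s eH pH).2].
have c1 s := (entire_continuous_vert H s eH).1.
have c2 s := (entire_continuous_vert H s eH).2.
have pi0 : 2 * pi != 0 :> R by rewrite mulf_neq0 // gt_eqF // pi_gt0.
have limRe k : (forall e, 0 < e -> exists s, forall t, normc (H (s +i* t) - k) <= e) ->
    segint 0 (2 * pi) (fun t => complex.Re (H (0 +i* t))) = complex.Re k * (2 * pi).
  move=> Hk; apply: (segint_limit (fun s t => complex.Re (H (s +i* t)))) => //.
  by move=> e /Hk[s Hs]; exists s => t; rewrite -raddfB; exact: le_trans (le_Re_normc _) (Hs t).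
have limIm k : (forall e, 0 < e -> exists s, forall t, normc (H (s +i* t) - k) <= e) ->
    segint 0 (2 * pi) (fun t => complex.Im (H (0 +i* t))) = complex.Im k * (2 * pi).
  move=> Hk; apply: (segint_limit (fun s t => complex.Im (H (s +i* t)))) => //.
  by move=> e /Hk[s Hs]; exists s => t; rewrite -raddfB; exact: le_trans (le_Im_normc _) (Hs t).
apply/eqP; rewrite eq_complex; apply/andP; split; apply/eqP.
  by apply: (mulIf pi0); rewrite -(limRe d small) (limRe 0 large).
by apply: (mulIf pi0); rewrite -(limIm d small) (limIm 0 large).
Qed.

(** Along the line t z, with t real, each component of [h] is a real function of t with zero
    derivative; [K] treats both components through their Lipschitz property. *)
Lemma deriv0_const h : (forall z, cdiff h z 0) -> forall z, h z = h 0.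
Proof.
move=> h0 z.
have K (f : R[i] -> R) : (forall z w, `|f z - f w| <= normc (z - w)) -> f (h z) = f (h 0).
  move=> fL; pose p t := f (h (t%:C * z)).
  have D t : is_derive t (1 : R) p 0.
    have L : (fun s => s^-1 *: (p (s *: 1 + t) - p t)) @ (0 : R)^' --> (0 : R).
      apply/cvgrPdist_le => e e0.
      have M0 : 0 < normc z + 1 by rewrite ltr_wpDl ?normc_ge0.
      have [r r0 Hr] := h0 (t%:C * z) (e / (normc z + 1)) (divr_gt0 e0 M0).
      rewrite near_withinE; apply/nbhs_normP; exists (r / (normc z + 1)) => /=; first by rewrite divr_gt0.
      move=> s; rewrite /= sub0r normrN ltr_pdivlMr // => sr s0.
      have ns : normc (s%:C * z) = `|s| * normc z by rewrite normcM /= expr0n addr0 sqrtr_sqr.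
      have := Hr (s%:C * z); rewrite ns mul0r subr0 => /(_ _)/wrap[].
        apply: le_lt_trans sr; rewrite ler_wpM2l // lerDl //.
      move=> B; rewrite sub0r normrN normrM normfV mulrC ler_pdivrMr ?normr_gt0 //.
      have -> : p (s *: 1 + t) = f (h (t%:C * z + s%:C * z)).
        by rewrite /p /GRing.scale /= mulr1 rmorphD mulrDl addrC.
      apply: le_trans (fL _ _) (le_trans B _).
      have -> : e * `|s| = e / (normc z + 1) * (`|s| * (normc z + 1)).
        by field; rewrite gt_eqF.
      by rewrite ler_wpM2l ?ler_wpM2l ?lerDl // ltW // divr_gt0.
    by apply: DeriveDef; [exact: cvgP L|exact/cvg_lim].
  have := @is_derive_0_is_cst R p 1 0 D.
  by rewrite /p mul1r mul0r.
apply/eqP; rewrite eq_complex; apply/andP; split; apply/eqP.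
  by apply: K => z' w'; rewrite -raddfB; exact: le_Re_normc.
by apply: K => z' w'; rewrite -raddfB; exact: le_Im_normc.
Qed.

Lemma liouville h B : entire h -> (forall z, normc (h z) <= B) -> forall z, h z = h 0.
Proof.
move=> eh hB; apply: deriv0_const => z; have /entireP /(_ z) [d hd] := eh.
by rewrite -(bounded_entire_deriv0 h B z d eh hB hd).
Qed.

End Liouville.

(** * Measurability of entire functions on the product space *)

Section PlaneMeasure.
Context {R : realType}.
Notation mu := (@lebesgue_measure R).
Notation RR := (measurableTypeR R * measurableTypeR R)%type.

(** The sigma-algebra is the one generated by measurable rectangles, so the preimage of an open
    interval is written as a countable union of boxes with rational corners. *)
Lemma measurable_continuous2 (F : R * R -> R) :
  (forall p e, 0 < e -> exists2 r : R, 0 < r & forall q : R * R,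
     `|q.1 - p.1| < r -> `|q.2 - p.2| < r -> `|F q - F p| < e) ->
  measurable_fun [set: RR] (F : RR -> measurableTypeR R).
Proof.
move=> cF; apply: (measurability _ (RGenOpens.measurableE R)).
move=> _ [_ [a [b ->]] <-]; rewrite setTI.
pose rect (k : rat * rat * (rat * rat)) : set RR :=
  `](ratr k.1.1 : R), (ratr k.1.2 : R)[%classic `*` `](ratr k.2.1 : R), (ratr k.2.2 : R)[%classic.
have -> : F @^-1` `]a, b[%classic =
   \bigcup_(k in [set k | rect k `<=` F @^-1` `]a, b[%classic]) rect k.
  apply/seteqP; split => [[x y] /=|p [k kF /kF]//].
  rewrite in_itv /= => /andP[aF Fb].
  pose e := Num.min (F (x, y) - a) (b - F (x, y)).
  have e0 : 0 < e by rewrite lt_min !subr_gt0 aF.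
  have [r r0 Hr] := cF (x, y) e e0.
  have q1 (z : R) : exists q : rat, ratr q \in `]z - r, z[ by apply: rat_in_itvoo; rewrite gtrBl.
  have q2 (z : R) : exists q : rat, ratr q \in `]z, z + r[ by apply: rat_in_itvoo; rewrite ltrDl.
  have [[p1 /itvP P1] [p2 /itvP P2]] := (q1 x, q2 x).
  have [[p3 /itvP P3] [p4 /itvP P4]] := (q1 y, q2 y).
  exists ((p1, p2), (p3, p4)); last by split; rewrite /= in_itv /= ?P1 ?P2 ?P3 ?P4.
  move=> [s t] [] /=; rewrite !in_itv /= => /andP[s1 s2] /andP[t1 t2].
  have := Hr (s, t); rewrite /= => /(_ _ _)/wrap[].
  - rewrite ltr_norml; apply/andP; split.
      have : x - r < ratr p1 by rewrite P1.
      by lra.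
    have : ratr p2 < x + r by rewrite P2.
    by lra.
  - rewrite ltr_norml; apply/andP; split.
      have : y - r < ratr p3 by rewrite P3.
      by lra.
    have : ratr p4 < y + r by rewrite P4.
    by lra.
  rewrite lt_min !ltr_norml => /andP[/andP[A1 A2] /andP[A3 A4]].
  by apply/andP; split; lra.
rewrite bigcup_mkcond; apply: countable_bigcupT_measurable; first exact: countableP.
move=> k; case: ifP => _; last exact: measurable0.
by apply: measurableX; exact: measurable_itv.
Qed.

Lemma measurable_entire (f : R[i] -> R[i]) : entire f ->
  measurable_fun [set: RR] (fun p : RR => complex.Re (f (cpt p)) : measurableTypeR R) /\
  measurable_fun [set: RR] (fun p : RR => complex.Im (f (cpt p)) : measurableTypeR R).
Proof.
move=> ef.
have K (h : R[i] -> R) : (forall z w, `|h z - h w| <= normc (z - w)) ->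
    measurable_fun [set: RR] (fun p : RR => h (f (cpt p)) : measurableTypeR R).
  move=> hL; apply: measurable_continuous2 => p e e0.
  have [r r0 Hr] := entire_eps f ef (cpt p) (e / 2) (divr_gt0 e0 (ltr0n _ 2)).
  exists (r / 2) => [|q q1 q2]; first by rewrite divr_gt0.
  apply: le_lt_trans (hL _ _) _.
  have -> : cpt q = cpt p + ((q.1 - p.1) +i* (q.2 - p.2)).
    by apply/eqP; rewrite eq_complex /=; apply/andP; split; apply/eqP; ring.
  apply: (@le_lt_trans _ _ (e / 2)); last by rewrite ltr_pdivrMr // ltr_pMr // ltr1n.
  apply: Hr; apply: le_lt_trans (normc_le _) _ => /=; lra.
by split; apply: K => z w; rewrite -raddfB; [exact: le_Re_normc|exact: le_Im_normc].
Qed.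

End PlaneMeasure.

(** * Affine substitutions on the line; translations and complex multiplications of the plane *)

Section ChangeOfVariable.
Context {R : realType}.
Notation mu := (@lebesgue_measure R).
Notation RT := (measurableTypeR R).
Notation RR := (measurableTypeR R * measurableTypeR R)%type.

Definition affine (s t : R) : RT -> RT := fun x => s * x + t.

Lemma measurable_affine s t : measurable_fun [set: RT] (affine s t).
Proof.
by apply: measurable_funD; [apply: measurable_funM; [exact: measurable_cst|exact: measurable_id]|exact: measurable_cst].
Qed.

Definition scaled_affine (s t : R) : {measure set RT -> \bar R}.
Proof.
pose nu : {measure set RT -> \bar R} := mscale (NngNum (normr_ge0 s)) (pushforward mu (affine s t)).
exact: (nu (measurable_affine s t)).
Defined.

(** By uniqueness of Lebesgue measure it suffices to compare on half-open intervals; a negative [s]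
    reverses them, so the preimage is then closed on the left. *)
Lemma lebesgue_measure_affine (s t : R) : s != 0 -> forall A : set RT, measurable A ->
  mu A = (`|s|%:E * mu (affine s t @^-1` A))%E.
Proof.
move=> s0 A mA.
rewrite (@lebesgue_measure_unique R (scaled_affine s t)) // => _ [[a b]] _ <-.
change (mu `]a, b]%classic = (`|s|%:E * mu (affine s t @^-1` `]a, b]%classic))%E).
have [s_gt0|s_le0] := ltP 0 s.
  have -> : affine s t @^-1` `]a, b]%classic = `](a - t) / s, (b - t) / s]%classic.
    apply/seteqP; split => x /=; rewrite !in_itv /affine /=;
      by rewrite ltr_pdivrMr // ler_pdivlMr // ltrBlDr lerBrDr mulrC.
  rewrite !lebesgue_measure_itv /= !lte_fin ltr_pM2r ?invr_gt0 // ltrD2r.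
  case: ifP => ab; last by rewrite mule0.
  rewrite -!EFinB -EFinM ger0_norm ?ltW //; congr EFin; field.
  by [].
have s_lt0 : s < 0 by rewrite lt_neqAle s0.
have -> : affine s t @^-1` `]a, b]%classic = `[(b - t) / s, (a - t) / s[%classic.
  apply/seteqP; split => x /=; rewrite !in_itv /affine /=;
    by rewrite ltr_ndivlMr // ler_ndivrMr // ltrBlDr lerBrDr mulrC andbC.
rewrite !lebesgue_measure_itv /= !lte_fin ltr_nM2r ?invr_lt0 // ltrD2r.
case: ifP => ab; last by rewrite mule0.
rewrite -!EFinB -EFinM ltr0_norm //; congr EFin; field.
by [].
Qed.

Local Open Scope ereal_scope.

Lemma ge0_integral_affine (s t : R) (G : RT -> \bar R) : (s != 0)%R ->
  measurable_fun setT G -> (forall x, 0 <= G x) ->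
  `|s|%:E * (\int[mu]_x G (s * x + t)%R) = \int[mu]_x G x.
Proof.
move=> s0 mG G0.
have -> : \int[mu]_x G x = \int[scaled_affine s t]_x G x.
  by apply: eq_measure_integral => A mA _; exact: lebesgue_measure_affine.
rewrite /scaled_affine ge0_integral_mscale //= ge0_integral_pushforward //.
exact: measurable_affine.
Qed.

Lemma ge0_integral_shift2 (q : R * R) (F : RR -> \bar R) :
  measurable_fun setT F -> (forall p, 0 <= F p) ->
  \int[@areaC R]_p F (p.1 + q.1, p.2 + q.2)%R = \int[@areaC R]_p F p.
Proof.
move=> mF F0; rewrite /areaC.
have mS : measurable_fun [set: RR] (fun p : RR => (p.1 + q.1, p.2 + q.2)%R : RR).
  by apply: measurable_fun_pair; apply: measurable_funD => //; exact: measurable_cst.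
rewrite fubini_tonelli2 //; last exact: measurableT_comp mF mS.
rewrite [RHS]fubini_tonelli2 // /fubini_G.
have m1 y : measurable_fun [set: RT] (fun x : RT => F (x, y)).
  by apply: measurableT_comp mF _; apply: measurable_fun_pair => //; exact: measurable_cst.
transitivity (\int[mu]_y \int[mu]_x F (x, (1 * y + q.2)%R)).
  apply: eq_integral => y _.
  have := @ge0_integral_affine 1 q.1 (fun x => F (x, (y + q.2)%R)) (oner_neq0 _) (m1 _) (fun=> F0 _).
  rewrite normr1 mul1e mul1r => <-.
  by apply: eq_integral => x _; rewrite mul1r.
have := @ge0_integral_affine 1 q.2 (fun y => \int[mu]_x F (x, y)) (oner_neq0 _).
rewrite normr1 mul1e; apply.
  exact: (measurable_fun_fubini_tonelli_G F mF F0).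
by move=> y; apply: integral_ge0.
Qed.

Definition mulp (a : R[i]) (p : R * R) : R * R :=
  (complex.Re a * p.1 - complex.Im a * p.2, complex.Im a * p.1 + complex.Re a * p.2)%R.

Lemma cpt_mulp a p : cpt (mulp a p) = (a * cpt p)%R.
Proof. by case: a => x y; case: p => u v; rewrite /cpt /mulp /= [RHS]/GRing.mul /= [(x * v + _)%R]addrC. Qed.

Lemma measurable_mulp a : measurable_fun [set: RR] (mulp a : RR -> RR).
Proof.
by apply: measurable_fun_pair; [apply: measurable_funB|apply: measurable_funD]; apply: measurable_funM => //; exact: measurable_cst.
Qed.

Lemma ge0_integral_mulp a (F : RR -> \bar R) : (a != 0)%R ->
  measurable_fun setT F -> (forall p, 0 <= F p) ->
  (abs2 a)%:E * \int[@areaC R]_p F (mulp a p) = \int[@areaC R]_p F p.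
Proof.
have K (b : R[i]) (G : RR -> \bar R) : (complex.Re b != 0)%R ->
    measurable_fun setT G -> (forall p, 0 <= G p) ->
    (abs2 b)%:E * \int[@areaC R]_p G (mulp b p) = \int[@areaC R]_p G p.
  (* For [x != 0], multiplication by [x + iy] is [(u, v) |-> (x u - y v, v)]
     followed by [(u, v) |-> (u, s v + k u)]: one affine substitution per variable. *)
  case: b => x y /= x0 mG G0; rewrite /areaC.
  (* [k] matches the coefficient of u in the second coordinate and [s] that of v; the Jacobians
     multiply to x s = x^2 + y^2. *)
  set N := abs2 _; pose s := (N / x)%R; pose k := (y / x)%R.
  have N0 : (0 < N)%R by rewrite /N /abs2 /= ltr_pwDl ?sqr_ge0 // exprn_even_gt0.
  have s0 : s != 0%R by rewrite mulf_neq0 ?invr_neq0 // gt_eqF.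
  pose G1 := (fun p : RR => G (p.1, (s * p.2 + k * p.1)%R)).
  have mG1 : measurable_fun setT G1.
    apply: measurableT_comp mG _; apply: measurable_fun_pair => //.
    by apply: measurable_funD; apply: measurable_funM => //; exact: measurable_cst.
  have G10 p : 0 <= G1 p by exact: G0.
  have mG1y v : measurable_fun [set: RT] (fun u : RT => G1 (u, v)).
    by apply: measurableT_comp mG1 _; apply: measurable_fun_pair => //; exact: measurable_cst.
  have mGx u : measurable_fun [set: RT] (fun v : RT => G (u, v)).
    by apply: measurableT_comp mG _; apply: measurable_fun_pair => //; exact: measurable_cst.
  have E1 : `|x|%:E * \int[mu \x mu]_p G (mulp (x +i* y) p) = \int[mu \x mu]_p G1 p.
    have mGm : measurable_fun setT (fun p : RR => G (mulp (x +i* y) p)).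
      exact: measurableT_comp mG (measurable_mulp _).
    rewrite fubini_tonelli2 // [RHS]fubini_tonelli2 // /fubini_G -ge0_integralZl_EFin //.
    - apply: eq_integral => v _.
      rewrite -(@ge0_integral_affine x (- y * v)%R (fun u => G1 (u, v)) x0 (mG1y v) (fun=> G10 _)).
      congr (_ * _); apply: eq_integral => u _; rewrite /G1 /mulp /=; congr (G (_, _)).
        by rewrite mulNr.
      by rewrite /s /k /N /abs2 /=; field.
    - by move=> v _; apply: integral_ge0.
    - exact: (measurable_fun_fubini_tonelli_G _ mGm (fun=> G0 _)).
  have E2 : `|s|%:E * \int[mu \x mu]_p G1 p = \int[mu \x mu]_p G p.
    rewrite fubini_tonelli1 // [RHS]fubini_tonelli1 // /fubini_F -ge0_integralZl_EFin //.
    - apply: eq_integral => u _.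
      exact: (@ge0_integral_affine s (k * u)%R (fun v => G (u, v)) s0 (mGx u) (fun=> G0 _)).
    - by move=> v _; apply: integral_ge0.
    - exact: (measurable_fun_fubini_tonelli_F _ mG1 (fun=> G10 _)).
  rewrite -E2 -E1 muleA -EFinM -normrM /s divfK //.
  by rewrite ger0_norm // ltW.
case: (eqVneq (complex.Re a) 0%R) => [ra0|]; last by move=> ? _; exact: K.
case: a ra0 => x y /= ->{x} a0 mF F0.
have y0 : (y != 0)%R by apply: contra a0 => /eqP ->.
have y2 : (y / 2 != 0)%R by rewrite mulf_neq0.
(* [iy] is the product of [1 + i] and [(y / 2) (1 + i)], which have nonzero real parts. *)
have K1 := K (1 +i* 1)%R F (oner_neq0 _) mF F0.
have mF1 := measurableT_comp mF (measurable_mulp (1 +i* 1)%R).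
have K2 := K ((y / 2) +i* (y / 2))%R _ y2 mF1 (fun=> F0 _).
rewrite -K1 -K2.
rewrite muleA -EFinM; congr (_%:E * _).
  by rewrite /abs2 /=; field.
apply: eq_integral => p _; congr (F _); rewrite /mulp /=; by congr pair; field.
Qed.

Lemma integral_shift2 (q : R * R) (F : RR -> \bar R) : measurable_fun setT F ->
  \int[@areaC R]_p F (p.1 + q.1, p.2 + q.2)%R = \int[@areaC R]_p F p.
Proof.
move=> mF; rewrite integralE [RHS]integralE; congr (_ - _).
  rewrite -(ge0_integral_shift2 q _ (measurable_funepos mF) (fun=> funepos_ge0 _ _)).
  by apply: eq_integral => p _; rewrite !funeposE.
rewrite -(ge0_integral_shift2 q _ (measurable_funeneg mF) (fun=> funeneg_ge0 _ _)).
by apply: eq_integral => p _; rewrite !funenegE.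
Qed.

Lemma integral_rot a (F : RR -> \bar R) : abs2 a = 1%R -> measurable_fun setT F ->
  \int[@areaC R]_p F (mulp a p) = \int[@areaC R]_p F p.
Proof.
move=> a1 mF; have a0 : (a != 0)%R.
  by apply/eqP => a0; move: a1; rewrite a0 /abs2 /= expr0n addr0 => /eqP; rewrite eq_sym oner_eq0.
have K G : measurable_fun setT G -> (forall p, 0 <= G p) -> \int[@areaC R]_p G (mulp a p) = \int[@areaC R]_p G p.
  by move=> mG G0; rewrite -(ge0_integral_mulp a G a0 mG G0) a1 mul1e.
rewrite integralE [RHS]integralE; congr (_ - _).
  rewrite -(K _ (measurable_funepos mF) (fun=> funepos_ge0 _ _)).
  by apply: eq_integral => p _; rewrite !funeposE.
rewrite -(K _ (measurable_funeneg mF) (fun=> funeneg_ge0 _ _)).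
by apply: eq_integral => p _; rewrite !funenegE.
Qed.

End ChangeOfVariable.

(** * Gaussian integrals through means over circles *)

Section CircleAverage.
Context {R : realType}.
Notation mu := (@lebesgue_measure R).
Notation RT := (measurableTypeR R).
Notation RR := (measurableTypeR R * measurableTypeR R)%type.

(* [areaC], as a constant that can carry a sigma-finite structure. *)
Definition area : set RR -> \bar R := (mu \x mu)%E.
HB.instance Definition _ := Measure.on area.

Lemma area_sigma_finite : sigma_finite setT area.
Proof.
pose F (n : nat) : set RT := `[(- n%:R : R), n%:R]%classic.
exists (fun n => F n `*` F n).
  apply/seteqP; split => // -[x y] _.
  exists (Num.truncn (Num.max `|x| `|y|)).+1 => //.
  have H : Num.max `|x| `|y| < (Num.truncn (Num.max `|x| `|y|)).+1%:R by exact: truncnS_gt.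
  move: H; rewrite gt_max => /andP[/ltW Hx /ltW Hy].
  by split; rewrite /F /= in_itv /= -ler_norml.
move=> n; have mF : measurable (F n) by exact: measurable_itv.
split; first exact: measurableX.
have M : (mu (F n) < +oo)%E.
  by rewrite lebesgue_measure_itv /=; case: ifP => _; rewrite ?ltry // -EFinB ltry.
rewrite /area product_measure1E // lte_mul_pinfty //.
by rewrite ge0_fin_numE.
Qed.

HB.instance Definition _ := Measure_isSigmaFinite.Build _ _ _ area area_sigma_finite.


Definition crot (t : R) : R * R -> R * R := mulp (expC (0 +i* t)).

Definition gauss_integrable (F : R * R -> R) : Prop :=
  area.-integrable setT (fun p : RR => (F p * gauss p)%:E).

Definition gauss_int (F : R * R -> R) : R := Rintegral area setT (fun p : RR => F p * gauss p).

Lemma gauss_ge0 (p : R * R) : 0 <= gauss p.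
Proof. by rewrite /gauss divr_ge0 ?expR_ge0 // pi_ge0. Qed.

Lemma abs2M (z w : R[i]) : abs2 (z * w) = abs2 z * abs2 w.
Proof. by case: z => a b; case: w => c d; rewrite /abs2 /=; ring. Qed.

Lemma abs2_cis (t : R) : abs2 (expC (0 +i* t)) = 1.
Proof. by rewrite abs2_expC /= mulr0 expR0. Qed.

Lemma gauss_rot t (p : R * R) : gauss (crot t p) = gauss p.
Proof. by rewrite /gauss cpt_mulp abs2M abs2_cis mul1r. Qed.

Lemma measurable_gauss : measurable_fun [set: RR] (@gauss R : RR -> RT).
Proof.
have -> : (@gauss R : RR -> RT) = (fun p : RR => expR (- (p.1 ^+ 2 + p.2 ^+ 2)) * pi^-1) by [].
apply: measurable_funM; last exact: measurable_cst.
apply: measurableT_comp; first exact: measurable_expR.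
apply: measurable_funN.
by apply: measurable_funD; apply: measurable_funX.
Qed.

(** The indicator extends the angle to the whole line, so that Fubini applies to the full product
    measure. The density is left unrotated, being rotation invariant. *)
Let Psi (F : R * R -> R) (q : RT * RR) : \bar R :=
  ((\1_(`[0, 2 * pi] : set R) q.1) * (F (crot q.1 q.2) * gauss q.2))%:E.

Lemma measurable_rot : measurable_fun [set: (RT * RR)%type] (fun q : RT * RR => crot q.1 q.2 : RR).
Proof.
have -> : (fun q : RT * RR => crot q.1 q.2 : RR) =
   (fun q : RT * RR => (cos q.1 * q.2.1 - sin q.1 * q.2.2, sin q.1 * q.2.1 + cos q.1 * q.2.2) : RR).
  by apply/funext => q; rewrite /crot expCE /cexp /mulp /= expR0 !mul1r.
have mc : measurable_fun [set: (RT * RR)%type] (fun q : RT * RR => cos q.1 : RT).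
  by apply: (measurableT_comp (f := @cos R : RT -> RT)) => //; apply: continuous_measurable_fun; exact: continuous_cos.
have ms : measurable_fun [set: (RT * RR)%type] (fun q : RT * RR => sin q.1 : RT).
  by apply: (measurableT_comp (f := @sin R : RT -> RT)) => //; apply: continuous_measurable_fun; exact: continuous_sin.
have m1 : measurable_fun [set: (RT * RR)%type] (fun q : RT * RR => q.2.1 : RT).
  by apply: (measurableT_comp (f := @fst R R : RR -> RT)).
have m2 : measurable_fun [set: (RT * RR)%type] (fun q : RT * RR => q.2.2 : RT).
  by apply: (measurableT_comp (f := @snd R R : RR -> RT)).
by apply: measurable_fun_pair; [apply: measurable_funB|apply: measurable_funD]; apply: measurable_funM.
Qed.

Lemma measurable_Psi F : measurable_fun [set: RR] (F : RR -> RT) -> measurable_fun setT (Psi F).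
Proof.
move=> mF; apply/measurable_EFinP; apply: measurable_funM.
  by apply: (measurableT_comp (f := \1_(`[0, 2 * pi] : set R) : RT -> RT)) => //; exact: measurable_indic.
apply: measurable_funM; first exact: (measurableT_comp mF measurable_rot).
by apply: (measurableT_comp measurable_gauss).
Qed.

Local Open Scope ereal_scope.

(** Rotation preserves area and density, so every angle in [0, 2 pi] gives the same inner
    integral. *)
Lemma integral_Psi2 F t : measurable_fun [set: RR] (F : RR -> RT) -> gauss_integrable F ->
  \int[area]_p Psi F (t, p) = (\1_(`[0%R, (2 * pi)%R] : set R) t * gauss_int F)%:E.
Proof.
move=> mF iF.
have E : (fun p => Psi F (t, p)) = (fun p => (\1_(`[0%R, (2 * pi)%R] : set R) t)%:E * (F (crot t p) * gauss (crot t p))%:E).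
  by apply/funext => p; rewrite /Psi gauss_rot -EFinM.
rewrite E; have := integral_rot (expC (0%R +i* t)) (fun p => (\1_(`[0%R, (2 * pi)%R] : set R) t)%:E * (F p * gauss p)%:E) (abs2_cis t).
rewrite -[@areaC R]/(area : set RR -> \bar R) => ->.
  rewrite integralZl // EFinM; congr (_ * _).
  by rewrite fineK //; exact: integrable_fin_num.
apply: emeasurable_funM; first exact: measurable_cst.
by apply/measurable_EFinP; apply: measurable_funM => //; exact: measurable_gauss.
Qed.

Lemma integral_indic_cst (k : R) :
  \int[mu]_t (\1_(`[0%R, (2 * pi)%R] : set R) t * k)%:E = (2 * pi * k)%:E.
Proof.
have M : mu `[0%R, (2 * pi)%R]%classic = (2 * pi)%:E.
  by rewrite lebesgue_measure_itv /= lte_fin mulr_gt0 ?pi_gt0 // -EFinB subr0.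
under eq_integral do rewrite EFinM.
rewrite integralZr //.
  rewrite integral_indic // setIT.
  exact: (congr1 (fun x => x * k%:E) M).
exact: (@integrable_indic_itv R 0 (2 * pi) true false).
Qed.

Lemma gauss_integrable_norm F : gauss_integrable F -> gauss_integrable (fun p => `|F p|%R).
Proof.
move=> iF; rewrite /gauss_integrable.
have -> : (fun p : RR => (`|F p| * gauss p)%:E) = (fun p : RR => `|(F p * gauss p)%:E|).
  by apply/funext => p; rewrite /= normrM (ger0_norm (gauss_ge0 _)).
exact: integrable_abse.
Qed.

(** The modulus of [Psi F] is [Psi] of |F|, so its iterated integral is 2 pi times the Gaussian
    integral of |F|. *)
Lemma integrable_Psi F : measurable_fun [set: RR] (F : RR -> RT) -> gauss_integrable F ->
  (mu \x area).-integrable setT (Psi F).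
Proof.
move=> mF iF; apply/integrable12ltyP; first exact: measurable_Psi.
have -> : (fun t => \int[area]_p `|Psi F (t, p)|) =
  (fun t => (\1_(`[0%R, (2 * pi)%R] : set R) t * gauss_int (fun p => `|F p|%R))%:E).
  apply/funext => t; rewrite -integral_Psi2; [|exact: measurableT_comp|exact: gauss_integrable_norm].
  apply: eq_integral => p _; rewrite /Psi abse_EFin 2!normrM; congr (_ * (_ * _))%:E.
    by rewrite ger0_norm // indicE ler0n.
  exact: ger0_norm (gauss_ge0 p).
by rewrite integral_indic_cst ltry.
Qed.

(* Fubini on [0, 2 pi] x C, using the rotation invariance of the Gaussian measure. *)
Lemma integral_circle_mean F : measurable_fun [set: RR] (F : RR -> RT) -> gauss_integrable F ->
  (forall p, continuous (fun t => F (crot t p))) ->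
  (2 * pi * gauss_int F)%:E = \int[area]_p (segint 0 (2 * pi) (fun t => F (crot t p)) * gauss p)%:E.
Proof.
move=> mF iF cF; rewrite -integral_indic_cst.
transitivity (\int[mu]_t \int[area]_p Psi F (t, p)).
  by apply: eq_integral => t _; rewrite integral_Psi2.
rewrite (integral12_prod_meas1 (integrable_Psi F mF iF)) -(integral21_prod_meas1 (integrable_Psi F mF iF)).
apply: eq_integral => p _; rewrite /fubini_G.
have cFg : continuous (fun t : R => F (crot t p) * gauss p)%R.
  by move=> t; apply: cvgMl; exact: cF.
have I := segint_integrable 0 (2 * pi)%R _ cFg.
have -> : (segint 0 (2 * pi) (fun t => F (crot t p)) * gauss p = segint 0 (2 * pi) (fun t => F (crot t p) * gauss p))%R.
  rewrite mulrC -segint_scale //; congr (segint _ _ _); apply/funext => t; exact: mulrC.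
rewrite /segint /Rintegral fineK; last exact: integrable_fin_num.
rewrite [RHS]integral_mkcond; apply: eq_integral => t _.
rewrite patchE /Psi.
transitivity (((t \in `[0%R, (2 * pi)%R]%classic)%:R * (F (crot t p) * gauss p))%R%:E); first by [].
by case: ifP => _; rewrite ?mul1r ?mul0r.
Qed.

(** The passage from Cauchy theory to the Fock space: it turns the mean value property into
    evaluation at 0, and [mean_dilation] into an adjoint formula. *)
Lemma eq_circle_mean F G : 
  measurable_fun [set: RR] (F : RR -> RT) -> gauss_integrable F -> (forall p, continuous (fun t => F (crot t p))) ->
  measurable_fun [set: RR] (G : RR -> RT) -> gauss_integrable G -> (forall p, continuous (fun t => G (crot t p))) ->
  (forall p, segint 0 (2 * pi) (fun t => F (crot t p)) = segint 0 (2 * pi) (fun t => G (crot t p))) ->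
  gauss_int F = gauss_int G.
Proof.
move=> mF iF cF mG iG cG FG.
have : (2 * pi * gauss_int F)%:E = (2 * pi * gauss_int G)%:E.
  rewrite !integral_circle_mean //; apply: eq_integral => p _; by rewrite FG.
by case => /mulfI; apply; rewrite mulf_neq0 // gt_eqF // pi_gt0.
Qed.

End CircleAverage.

(** * Sesquilinear algebra of the Fock inner product *)

Section FockInner.
Context {R : realType}.
Notation RT := (measurableTypeR R).
Notation RR := (measurableTypeR R * measurableTypeR R)%type.
Implicit Types (f g h : R[i] -> R[i]) (c z w : R[i]).

Lemma abs2_ge0 z : 0 <= abs2 z.
Proof. by rewrite /abs2 addr_ge0 ?sqr_ge0. Qed.

(* [x^*] parses as [Num.conj] or as [conjc] depending on the innermost scope. *)
Lemma conjE z : Num.conj z = conjc z.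
Proof. by []. Qed.

Lemma conjM z w : conjc (z * w) = conjc z * conjc w.
Proof. exact: rmorphM. Qed.

Lemma conjD z w : conjc (z + w) = conjc z + conjc w.
Proof. exact: rmorphD. Qed.

Lemma Re_mulJ z w : complex.Re (z * w^*) = complex.Re z * complex.Re w + complex.Im z * complex.Im w.
Proof. by case: z => a b; case: w => c d /=; ring. Qed.

Lemma Im_mulJ z w : complex.Im (z * w^*) = complex.Im z * complex.Re w - complex.Re z * complex.Im w.
Proof. by case: z => a b; case: w => c d /=; ring. Qed.

Lemma abs2_mulJ z : abs2 z = complex.Re (z * z^*).
Proof. by rewrite Re_mulJ /abs2 !expr2. Qed.

Lemma measurable_mulJ f g : entire f -> entire g ->
  measurable_fun [set: RR] (fun p : RR => complex.Re (f (cpt p) * (g (cpt p))^*) : RT) /\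
  measurable_fun [set: RR] (fun p : RR => complex.Im (f (cpt p) * (g (cpt p))^*) : RT).
Proof.
move=> /measurable_entire[f1 f2] /measurable_entire[g1 g2]; split.
  under eq_fun do rewrite Re_mulJ.
  by apply: measurable_funD; apply: measurable_funM.
under eq_fun do rewrite Im_mulJ.
by apply: measurable_funB; apply: measurable_funM.
Qed.

Lemma measurable_abs2 f : entire f -> measurable_fun [set: RR] (fun p : RR => abs2 (f (cpt p)) : RT).
Proof.
move=> ef; under eq_fun do rewrite abs2_mulJ.
by have [] := measurable_mulJ f f ef ef.
Qed.

Lemma measurable_mul_gauss (F : R * R -> R) : measurable_fun [set: RR] (F : RR -> RT) ->
  measurable_fun [set: RR] (fun p : RR => (F p * gauss p)%:E).
Proof.
move=> mF; apply/measurable_EFinP; apply: measurable_funM => //; exact: measurable_gauss.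
Qed.

Lemma inF2P f : inF2 f <-> entire f /\ gauss_integrable (fun p => abs2 (f (cpt p))).
Proof.
split=> -[ef nf]; split => //.
  apply/integrableP; split; first exact: (measurable_mul_gauss _ (measurable_abs2 f ef)).
  apply: le_lt_trans nf; rewrite le_eqVlt; apply/orP; left; apply/eqP.
  by apply: eq_integral => p _; rewrite gee0_abs // lee_fin; apply: mulr_ge0; [exact: abs2_ge0|exact: gauss_ge0].
move/integrableP : nf => [_]; apply: le_lt_trans.
rewrite le_eqVlt; apply/orP; left; apply/eqP.
by apply: eq_integral => p _; rewrite gee0_abs // lee_fin; apply: mulr_ge0; [exact: abs2_ge0|exact: gauss_ge0].
Qed.

Lemma gauss_integrable_le (F G : R * R -> R) : measurable_fun [set: RR] (F : RR -> RT) ->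
  (forall p, `|F p| <= G p) -> gauss_integrable G -> gauss_integrable F.
Proof.
move=> mF FG iG; apply: le_integrable iG => //; first exact: measurable_mul_gauss.
move=> p _; rewrite lee_fin !normrM ler_wpM2r //.
by apply: le_trans (FG p) (ler_norm _).
Qed.

Lemma gauss_integrableD (F G : R * R -> R) : gauss_integrable F -> gauss_integrable G -> gauss_integrable (fun p => F p + G p).
Proof.
move=> iF iG; rewrite /gauss_integrable.
have -> : (fun p : RR => ((F p + G p) * gauss p)%:E) =
   ((fun p : RR => (F p * gauss p)%:E) \+ (fun p : RR => (G p * gauss p)%:E))%E.
  by apply/funext => p; rewrite mulrDl EFinD.
exact: integrableD.
Qed.

Lemma gauss_integrableZ (k : R) (F : R * R -> R) : gauss_integrable F -> gauss_integrable (fun p => k * F p).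
Proof.
move=> iF; rewrite /gauss_integrable.
have -> : (fun p : RR => (k * F p * gauss p)%:E) = (fun p : RR => k%:E * (F p * gauss p)%:E)%E.
  by apply/funext => p; rewrite -mulrA EFinM.
exact: integrableZl.
Qed.

Lemma gauss_intD (F G : R * R -> R) : gauss_integrable F -> gauss_integrable G -> gauss_int (fun p => F p + G p) = gauss_int F + gauss_int G.
Proof.
move=> iF iG; rewrite /gauss_int -RintegralD //.
by apply: eq_Rintegral => p _; rewrite mulrDl.
Qed.

Lemma gauss_intZ (k : R) (F : R * R -> R) : gauss_integrable F -> gauss_int (fun p => k * F p) = k * gauss_int F.
Proof.
move=> iF; rewrite /gauss_int -RintegralZl //.
by apply: eq_Rintegral => p _; rewrite mulrA.
Qed.

Lemma norm_mulD_le (x y u v : R) : `|x * u + y * v| <= x ^+ 2 + y ^+ 2 + (u ^+ 2 + v ^+ 2).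
Proof.
have := sqr_ge0 (x + u); have := sqr_ge0 (y + v); have := sqr_ge0 (x - u); have := sqr_ge0 (y - v).
have := sqr_ge0 x; have := sqr_ge0 y; have := sqr_ge0 u; have := sqr_ge0 v.
by rewrite ler_norml => *; apply/andP; split; nra.
Qed.

(** Both components of f times the conjugate of g are dominated by |f|^2 + |g|^2. *)
Lemma gauss_integrable_mulJ f g : inF2 f -> inF2 g ->
  gauss_integrable (fun p => complex.Re (f (cpt p) * (g (cpt p))^*)) /\
  gauss_integrable (fun p => complex.Im (f (cpt p) * (g (cpt p))^*)).
Proof.
move=> /inF2P[ef nf] /inF2P[eg ng]; have [m1 m2] := measurable_mulJ f g ef eg.
have S := gauss_integrableD _ _ nf ng.
split; [apply: gauss_integrable_le m1 _ S|apply: gauss_integrable_le m2 _ S] => p.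
  by rewrite Re_mulJ; exact: norm_mulD_le.
rewrite Im_mulJ -mulNr; apply: le_trans (norm_mulD_le _ _ _ _) _.
by rewrite sqrrN /abs2 lerD2r addrC.
Qed.

Lemma fock_innerE f g : fock_inner f g =
  gauss_int (fun p => complex.Re (f (cpt p) * (g (cpt p))^*)) +i* gauss_int (fun p => complex.Im (f (cpt p) * (g (cpt p))^*)).
Proof. by []. Qed.

Lemma fock_norm2E_inner f : fock_norm2 f = complex.Re (fock_inner f f).
Proof.
rewrite fock_innerE /=; apply: (congr1 gauss_int); apply/funext => p; exact: abs2_mulJ.
Qed.

Lemma inF2Z c f : inF2 f -> inF2 (fun z => c * f z).
Proof.
move=> /inF2P[ef nf]; apply/inF2P; split; first exact: entireZ.
by under eq_fun do rewrite abs2M; exact: gauss_integrableZ.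
Qed.

Lemma inF2D f g : inF2 f -> inF2 g -> inF2 (fun z => f z + g z).
Proof.
move=> /inF2P[ef nf] /inF2P[eg ng]; have efg := entireD f g ef eg.
apply/inF2P; split => //; apply: (gauss_integrable_le _ (fun p => 2 * (abs2 (f (cpt p)) + abs2 (g (cpt p))))).
- exact: (measurable_abs2 _ efg).
- move=> p; rewrite ger0_norm ?abs2_ge0 // /abs2 !raddfD /=.
  set x := complex.Re (f _); set y := complex.Re (g _); set u := complex.Im (f _); set v := complex.Im (g _).
  by have := sqr_ge0 (x - y); have := sqr_ge0 (u - v); nra.
- by apply: gauss_integrableZ; apply: gauss_integrableD.
Qed.

Lemma innerC f g : inF2 f -> inF2 g -> fock_inner g f = (fock_inner f g)^*.
Proof.
move=> nf ng; have [_ iI] := gauss_integrable_mulJ f g nf ng.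
rewrite !fock_innerE /=; congr (_ +i* _).
  by apply: (congr1 gauss_int); apply/funext => p; rewrite !Re_mulJ; ring.
rewrite -[RHS]mulN1r -gauss_intZ //.
by apply: (congr1 gauss_int); apply/funext => p; rewrite !Im_mulJ; ring.
Qed.

Lemma innerDl f g h : inF2 f -> inF2 g -> inF2 h ->
  fock_inner (fun z => f z + g z) h = fock_inner f h + fock_inner g h.
Proof.
move=> nf ng nh; have [f1 f2] := gauss_integrable_mulJ f h nf nh; have [g1 g2] := gauss_integrable_mulJ g h ng nh.
rewrite !fock_innerE; apply/eqP; rewrite eq_complex /= -!gauss_intD //.
by apply/andP; split; apply/eqP; apply: (congr1 gauss_int); apply/funext => p; rewrite mulrDl raddfD.
Qed.

Lemma innerZl c f g : inF2 f -> inF2 g ->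
  fock_inner (fun z => c * f z) g = c * fock_inner f g.
Proof.
move=> nf ng; have [f1 f2] := gauss_integrable_mulJ f g nf ng.
rewrite !fock_innerE; apply/eqP; rewrite eq_complex Re_mulr Im_mulr [complex.Re (_ +i* _)]/= [complex.Im (_ +i* _)]/=.
rewrite [complex.Re (gauss_int _ +i* gauss_int _)]/= [complex.Im (gauss_int _ +i* gauss_int _)]/=.
rewrite -mulNr -!gauss_intZ // -!gauss_intD //; try exact: gauss_integrableZ.
apply/andP; split; apply/eqP; apply: (congr1 gauss_int); apply/funext => p; rewrite -mulrA ?Re_mulr ?Im_mulr.
  by rewrite mulNr.
by rewrite Re_mulr.
Qed.

Lemma innerZr c f g : inF2 f -> inF2 g ->
  fock_inner f (fun z => c * g z) = c^* * fock_inner f g.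
Proof.
move=> nf ng; rewrite (innerC _ _ (inF2Z c g ng) nf) (innerZl c g f ng nf) conjM.
by congr (_ * _); exact: esym (innerC g f ng nf).
Qed.

Lemma inner_norm f : inF2 f -> fock_inner f f = (fock_norm2 f)%:C.
Proof.
move=> nf; rewrite fock_norm2E_inner; have := innerC f f nf nf.
case: (fock_inner f f) => x y /eqP; rewrite eq_complex /= => /andP[_ /eqP H].
by apply/eqP; rewrite eq_complex /= eqxx; apply/eqP; lra.
Qed.

Lemma norm2Z c f : inF2 f -> fock_norm2 (fun z => c * f z) = abs2 c * fock_norm2 f.
Proof.
move=> nf; rewrite fock_norm2E_inner (innerZl c f _ nf (inF2Z c f nf)) (innerZr c f f nf nf) inner_norm // mulrA.
by rewrite Re_mulr /= mulr0 subr0 -abs2_mulJ.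
Qed.

Lemma fock_norm2_ge0 f : 0 <= fock_norm2 f.
Proof.
by apply: Rintegral_ge0 => p _; apply: mulr_ge0; [exact: abs2_ge0|exact: gauss_ge0].
Qed.

(** Used twice: to bound evaluation at 0, and to show that an approximate eigenvector defect
    vanishes. *)
Lemma norm2_subZ c f g : inF2 f -> inF2 g ->
  fock_norm2 (fun z => f z - c * g z) =
  fock_norm2 f - 2 * complex.Re (c^* * fock_inner f g) + abs2 c * fock_norm2 g.
Proof.
move=> nf ng; have nc : inF2 (fun z => (- c) * g z) by exact: inF2Z.
have -> : (fun z => f z - c * g z) = (fun z => f z + (- c) * g z).
  by apply/funext => z; rewrite mulNr.
have nh := inF2D _ _ nf nc.
have E1 := innerDl f _ _ nf nc nh.
have E2 : fock_inner f (fun z => f z + (- c) * g z) = fock_inner f f + (- c)^* * fock_inner f g.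
  rewrite (innerC _ _ nh nf) (innerDl f _ _ nf nc nf) conjD -(innerZr (- c) f g nf ng).
  by congr (_ + _); [exact: esym (innerC f f nf nf)|exact: esym (innerC _ _ nc nf)].
have E3 : fock_inner (fun z => (- c) * g z) (fun z => f z + (- c) * g z) =
    (- c) * (fock_inner f g)^* + (fock_norm2 (fun z => (- c) * g z))%:C.
  rewrite (innerC _ _ nh nc) (innerDl f _ _ nf nc nc) conjD -inner_norm //.
  congr (_ + _); last exact: esym (innerC _ _ nc nc).
  apply: (etrans (esym (innerC f _ nf nc))); rewrite innerZl //; congr (_ * _).
  exact: innerC.
rewrite fock_norm2E_inner E1 E2 E3 norm2Z // inner_norm //.
have -> : abs2 (- c) = abs2 c by rewrite /abs2 !raddfN /= !sqrrN.
case: (fock_inner f g) => x y; case: c {nc nh E1 E2 E3} => u v /=; ring.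
Qed.

End FockInner.

(** * Normalization of the measure, Weyl unitaries and the reproducing property *)

Section Operators.
Context {R : realType}.
Notation mu := (@lebesgue_measure R).
Notation RT := (measurableTypeR R).
Notation RR := (measurableTypeR R * measurableTypeR R)%type.
Implicit Types (f g h : R[i] -> R[i]) (a c q z w : R[i]).

(** A centred normal law of variance 1/2 has density e^(-x^2) / sqrt pi, and [gauss] is the product
    of two of these; hence its total mass 1. *)
Let sigma : R := Num.sqrt 2^-1.

Let sigma2 : sigma ^+ 2 = 2^-1.
Proof. by rewrite sqr_sqrtr // invr_ge0. Qed.

Let sigma_neq0 : sigma != 0.
Proof. by rewrite gt_eqF // sqrtr_gt0 invr_gt0. Qed.

Lemma gauss_normal_pdf (p : R * R) : gauss p = normal_pdf 0 sigma p.1 * normal_pdf 0 sigma p.2.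
Proof.
have s1 : sigma ^+ 2 *+ 2 = 1 :> R by rewrite sigma2 -mulr_natr mulVf.
have pk : normal_peak sigma = (Num.sqrt pi)^-1.
  by rewrite /normal_peak -mulrnAl s1 mul1r.
rewrite !normal_pdfE // pk /normal_fun !subr0 s1 !divr1.
rewrite mulrACA -expRD -invfM -expr2 sqr_sqrtr ?pi_ge0 // /gauss /abs2 /=.
by rewrite opprD mulrC.
Qed.

Lemma integral_gauss : (\int[@area R]_p (gauss p)%:E = 1)%E.
Proof.
rewrite /area fubini_tonelli1 //=.
- rewrite -[RHS](@integral_normal_pdf R 0 sigma); apply: eq_integral => x _.
  rewrite /fubini_F; under eq_integral do rewrite gauss_normal_pdf EFinM /=.
  rewrite ge0_integralZl //=.
  + by rewrite integral_normal_pdf // mule1.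
  + by apply/measurable_EFinP; exact: measurable_normal_pdf.
  + by move=> y _; rewrite lee_fin normal_pdf_ge0.
  + by rewrite lee_fin normal_pdf_ge0.
- by apply/measurable_EFinP; exact: measurable_gauss.
- by move=> p; rewrite lee_fin; exact: gauss_ge0.
Qed.

Lemma gauss_integrable_cst (k : R) : gauss_integrable (fun=> k).
Proof.
rewrite /gauss_integrable; apply/integrableP; split.
  exact: (measurable_mul_gauss _ (@measurable_cst _ _ RR RT setT k)).
have -> : (fun p : RR => `|(k * gauss p)%:E|)%E = (fun p : RR => `|k|%:E * (gauss p)%:E)%E.
  by apply/funext => p; rewrite abse_EFin normrM (ger0_norm (gauss_ge0 p)) EFinM.
rewrite ge0_integralZl ?integral_gauss ?mule1 ?ltry //.
- by apply/measurable_EFinP; exact: measurable_gauss.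
- by move=> p _; rewrite lee_fin; exact: gauss_ge0.
Qed.

Lemma gauss_int_cst (k : R) : gauss_int (fun=> k) = k.
Proof.
rewrite -[in LHS](mulr1 k) (gauss_intZ k (fun=> 1)); last exact: gauss_integrable_cst.
rewrite /gauss_int /Rintegral; under eq_integral do rewrite mul1r.
by rewrite integral_gauss mulr1.
Qed.

Lemma inF2_cst c : inF2 (fun=> c).
Proof. by apply/inF2P; split; [exact: entire_cst|exact: gauss_integrable_cst]. Qed.

Lemma cpt_rot t (p : R * R) : cpt (crot t p) = expC (0 +i* t) * cpt p.
Proof. exact: cpt_mulp. Qed.

Lemma continuous_rot f : entire f -> forall p : R * R,
  continuous (fun t : R => complex.Re (f (cpt (crot t p)))) /\
  continuous (fun t : R => complex.Im (f (cpt (crot t p)))).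
Proof.
move=> ef p; have e1 := entire_comp f _ ef (entireMr (cpt p) entire_expC).
have [c1 c2] := entire_continuous_vert _ 0 e1.
by split; [have -> : (fun t : R => complex.Re (f (cpt (crot t p)))) = (fun t => complex.Re (f (expC (0 +i* t) * cpt p))) |
 have -> : (fun t : R => complex.Im (f (cpt (crot t p)))) = (fun t => complex.Im (f (expC (0 +i* t) * cpt p)))] => //;
 apply/funext => t; rewrite cpt_rot.
Qed.

Lemma continuous_rot_mulJ f g : entire f -> entire g -> forall p : R * R,
  continuous (fun t : R => complex.Re (f (cpt (crot t p)) * (g (cpt (crot t p)))^*)) /\
  continuous (fun t : R => complex.Im (f (cpt (crot t p)) * (g (cpt (crot t p)))^*)).
Proof.
move=> ef eg p; have [f1 f2] := continuous_rot f ef p; have [g1 g2] := continuous_rot g eg p.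
split.
  under eq_fun do rewrite Re_mulJ.
  by move=> t; apply: cvgD; apply: cvgM; [exact: f1|exact: g1|exact: f2|exact: g2].
under eq_fun do rewrite Im_mulJ.
by move=> t; apply: cvgB; apply: cvgM; [exact: f2|exact: g1|exact: f1|exact: g2].
Qed.

(** The reproducing property at 0: on every circle [h] and the constant [h 0] have the same mean. *)
Lemma inner_1 h : inF2 h -> fock_inner h (fun=> 1) = h 0.
Proof.
move=> nh; have [eh _] := nh.
have n1 : inF2 (fun=> 1) := inF2_cst 1.
have [i1 i2] := gauss_integrable_mulJ h _ nh n1.
have [m1 m2] := measurable_mulJ h _ eh (entire_cst 1).
have cc (k : R) (p : R * R) : continuous (fun _ : R => k) by exact: cst_continuous.
have pi0 : 0 <= 2 * pi :> R by rewrite mulr_ge0 ?pi_ge0.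
rewrite fock_innerE; apply/eqP; rewrite eq_complex; apply/andP; split; apply/eqP.
  rewrite -[RHS]gauss_int_cst; apply: eq_circle_mean => //.
  - by move=> p; exact: (continuous_rot_mulJ h _ eh (entire_cst 1) p).1.
  - exact: gauss_integrable_cst.
  - exact: cc.
  - move=> p; rewrite segint_cst // subr0 -(mean_value h (cpt p) eh).1.
    congr (segint _ _ _); apply/funext => t; by rewrite Re_mulJ /= mulr1 mulr0 addr0 cpt_rot.
rewrite -[RHS]gauss_int_cst; apply: eq_circle_mean => //.
- by move=> p; exact: (continuous_rot_mulJ h _ eh (entire_cst 1) p).2.
- exact: gauss_integrable_cst.
- exact: cc.
- move=> p; rewrite segint_cst // subr0 -(mean_value h (cpt p) eh).2.
  congr (segint _ _ _); apply/funext => t; by rewrite Im_mulJ /= mulr1 mulr0 subr0 cpt_rot.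
Qed.

Lemma norm2_1 : fock_norm2 (fun=> 1 : R[i]) = 1.
Proof. by rewrite fock_norm2E_inner inner_1 //; exact: inF2_cst. Qed.

(** Subtracting from [h] its projection [h 0] onto the constants leaves squared norm |h|^2 - |h
    0|^2, which is nonnegative. *)
Lemma abs2_0_le h : inF2 h -> abs2 (h 0) <= fock_norm2 h.
Proof.
move=> nh; have := fock_norm2_ge0 (fun z => h z - h 0 * 1).
rewrite norm2_subZ // ?inner_1 //; last exact: inF2_cst.
have -> : complex.Re ((h 0)^* * h 0) = abs2 (h 0) by rewrite abs2_mulJ mulrC.
by rewrite norm2_1; lra.
Qed.

(* The Weyl (translation) unitaries of the Fock space. *)
Definition weyl q f z := expC (q^* * z - (abs2 q / 2)%:C) * f (z - q).

(** Written with added opposites to match the form of the translation lemmas. *)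
Let tr q (p : R * R) : R * R := (p.1 + - complex.Re q, p.2 + - complex.Im q).

Lemma cpt_tr q p : cpt (tr q p) = cpt p - q.
Proof. by rewrite /cpt /tr; case: q. Qed.

(** Completing the square: the Weyl factor turns the density at z into the density at z - q, which
    is why [weyl q] is isometric. *)
Lemma gauss_tr q p : abs2 (expC (q^* * cpt p - (abs2 q / 2)%:C)) * gauss p = gauss (tr q p).
Proof.
rewrite abs2_expC /gauss mulrA -expRD; congr (expR _ / _).
by case: q => x y; case: p => u v; rewrite /abs2 /tr /cpt /=; field.
Qed.

Lemma weyl_mulJ q f g p :
  weyl q f (cpt p) * (weyl q g (cpt p))^* =
  (abs2 (expC (q^* * cpt p - (abs2 q / 2)%:C)))%:C * (f (cpt (tr q p)) * (g (cpt (tr q p)))^*).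
Proof.
rewrite cpt_tr /weyl !conjE conjM; set E := expC _.
have -> : (abs2 E)%:C = E * E^*.
  by case: E => x y; apply/eqP; rewrite eq_complex /abs2 /=; apply/andP; split; apply/eqP; ring.
ring.
Qed.

Lemma weyl_mulJ_gauss q f g p :
  complex.Re (weyl q f (cpt p) * (weyl q g (cpt p))^*) * gauss p =
    complex.Re (f (cpt (tr q p)) * (g (cpt (tr q p)))^*) * gauss (tr q p) /\
  complex.Im (weyl q f (cpt p) * (weyl q g (cpt p))^*) * gauss p =
    complex.Im (f (cpt (tr q p)) * (g (cpt (tr q p)))^*) * gauss (tr q p).
Proof.
rewrite -gauss_tr weyl_mulJ Re_mulr Im_mulr /= !mul0r subr0 addr0.
by split; ring.
Qed.

Lemma entire_weyl q f : entire f -> entire (weyl q f).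
Proof.
move=> ef.
have e1 : entire (fun z => q^* * z - (abs2 q / 2)%:C) := entireD _ _ (entireZ (q^*) entire_id) (entire_cst _).
have e2 : entire (fun z => z - q) := entireD _ _ entire_id (entire_cst _).
exact: (entireM _ _ (entire_comp (@expC R) _ entire_expC e1) (entire_comp f _ ef e2)).
Qed.

Lemma inF2_weyl q f : inF2 f -> inF2 (weyl q f).
Proof.
move=> /inF2P[ef nf]; apply/inF2P; have ew := entire_weyl q f ef; split => //.
pose Phi (p : RR) : \bar R := (abs2 (f (cpt p)) * gauss p)%:E.
apply/integrableP; split; first exact: (measurable_mul_gauss _ (measurable_abs2 _ ew)).
have -> : (fun p : RR => `|(abs2 (weyl q f (cpt p)) * gauss p)%:E|)%E = (fun p => `|Phi (tr q p)|)%E.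
  by apply/funext => p; rewrite /Phi !abs2_mulJ (weyl_mulJ_gauss q f f p).1.
move/integrableP : nf => [mf]; apply: le_lt_trans; rewrite le_eqVlt; apply/orP; left; apply/eqP.
apply: (@ge0_integral_shift2 R (- complex.Re q, - complex.Im q) (fun p => `|Phi p|%E)) => //.
exact: measurableT_comp mf.
Qed.

Lemma weyl_isometry q f g : entire f -> entire g -> fock_inner (weyl q f) (weyl q g) = fock_inner f g.
Proof.
move=> ef eg; rewrite !fock_innerE; have [m1 m2] := measurable_mulJ f g ef eg; congr (_ +i* _).
  rewrite /gauss_int /Rintegral; congr fine.
  rewrite -[RHS](integral_shift2 (- complex.Re q, - complex.Im q) _ (measurable_mul_gauss _ m1)).
  by apply: eq_integral => p _; rewrite (weyl_mulJ_gauss q f g p).1.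
rewrite /gauss_int /Rintegral; congr fine.
rewrite -[RHS](integral_shift2 (- complex.Re q, - complex.Im q) _ (measurable_mul_gauss _ m2)).
by apply: eq_integral => p _; rewrite (weyl_mulJ_gauss q f g p).2.
Qed.

Lemma weylK q f : weyl (- q) (weyl q f) = f.
Proof.
apply/funext => z; rewrite /weyl mulrA -expCD opprK addrK.
rewrite (_ : _ + _ = 0) ?expC0 ?mul1r //.
by case: q => x y; case: z => u v; apply/eqP; rewrite eq_complex /abs2 /=; apply/andP; split; apply/eqP; field.
Qed.

Lemma weyl_adjoint q f g : entire f -> entire g -> fock_inner (weyl q f) g = fock_inner f (weyl (- q) g).
Proof.
move=> ef eg; have E := weylK (- q) g; rewrite opprK in E.
rewrite -{1}E; exact: (weyl_isometry q f _ ef (entire_weyl (- q) g eg)).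
Qed.

Lemma weyl_norm q f : entire f -> fock_norm2 (weyl q f) = fock_norm2 f.
Proof. by move=> ef; rewrite !fock_norm2E_inner weyl_isometry. Qed.

Lemma weyl_N_0 w f : weyl (- w) f 0 = expC (- (abs2 w / 2)%:C) * f w.
Proof. by rewrite /weyl mulr0 !sub0r opprK /abs2 !raddfN /= !sqrrN. Qed.

(** Every kernel is a multiple of a translate of K_0 = 1, so kernel properties reduce to
    [inner_1]. *)
Lemma fockK_weyl w : fockK w = (fun z => expC (abs2 w / 2)%:C * weyl w (fun=> 1) z).
Proof.
apply/funext => z; have -> : weyl w (fun=> 1) z = expC (w^* * z - (abs2 w / 2)%:C) by exact: mulr1.
rewrite -expCD /fockK; congr expC.
by move: (_%:C) (_ * z) => u v; rewrite addrC subrK.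
Qed.

Lemma inF2_fockK w : inF2 (fockK w).
Proof. by rewrite fockK_weyl; apply/inF2Z/inF2_weyl/inF2_cst. Qed.

Lemma reproducing f w : inF2 f -> fock_inner f (fockK w) = f w.
Proof.
move=> nf; have [ef _] := nf.
have n1 := inF2_weyl w _ (inF2_cst 1).
rewrite fockK_weyl (innerZr _ f _ nf n1).
have := weyl_adjoint (- w) f (fun=> 1) ef (entire_cst 1).
rewrite opprK => <-; rewrite inner_1; last exact: inF2_weyl.
rewrite weyl_N_0 mulrA conjE -expC_conj -expCD.
rewrite (_ : _ + _ = 0) ?expC0 ?mul1r //.
by apply/eqP; rewrite eq_complex /=; apply/andP; split; apply/eqP; ring.
Qed.

(** The bound at 0 applied to [weyl (- w) f], whose value at 0 is e^(-|w|^2 / 2) f(w). *)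
Lemma pointwise_bound f w : inF2 f -> abs2 (f w) <= expR (abs2 w) * fock_norm2 f.
Proof.
move=> nf; have [ef _] := nf.
have := abs2_0_le _ (inF2_weyl (- w) f nf).
rewrite weyl_norm // weyl_N_0 abs2M abs2_expC /=.
have -> : 2 * - (abs2 w / 2) = - abs2 w by field.
by rewrite expRN mulrC ler_pdivrMr ?expR_gt0 // mulrC.
Qed.

End Operators.

(** * Dilations: norms, boundedness and adjoints *)

Section Dilation.
Context {R : realType}.
Notation RT := (measurableTypeR R).
Notation RR := (measurableTypeR R * measurableTypeR R)%type.
Implicit Types (f g h : R[i] -> R[i]) (a c q z w : R[i]).

Definition dil a f z := f (a * z).

Lemma entire_dil a f : entire f -> entire (dil a f).
Proof. by move=> ef; exact: (entire_comp f _ ef (entireZ a entire_id)). Qed.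

Lemma abs2_gt0 a : a != 0 -> 0 < abs2 a.
Proof.
case: a => x y; rewrite eq_complex /= negb_and /abs2 /= => /orP[x0|y0].
  by rewrite ltr_pwDl ?sqr_ge0 // exprn_even_gt0.
by rewrite ltr_wpDl ?sqr_ge0 // exprn_even_gt0.
Qed.

Lemma abs2V a : abs2 a^-1 = (abs2 a)^-1.
Proof.
have [->|a0] := eqVneq a 0; first by rewrite invr0 /abs2 /= expr0n addr0 invr0.
have N := abs2_gt0 a a0; apply: (mulIf (lt0r_neq0 N)).
by rewrite mulVf ?gt_eqF // -abs2M mulVf // /abs2 /= expr1n expr0n addr0.
Qed.

Lemma abs2J a : abs2 (conjc a) = abs2 a.
Proof. by case: a => x y; rewrite /abs2 /= sqrrN. Qed.

(* The right-hand side depends on [a] only through its modulus, so that [dil a]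
   and its adjoint [dil a^*] have equal norms at every [f]. *)
Lemma dil_norm2E a f : a != 0 -> entire f ->
  ((abs2 a)%:E * fock_norm2E (dil a f) =
   \int[@area R]_p (abs2 (f (cpt p)) * (expR (- (abs2 (cpt p) / abs2 a)) / pi))%:E)%E.
Proof.
move=> a0 ef; have A0 := abs2_gt0 a a0.
pose F (p : RR) : \bar R := (abs2 (f (cpt p)) * (expR (- (abs2 (cpt p) / abs2 a)) / pi))%:E.
have mF : measurable_fun setT F.
  apply/measurable_EFinP; apply: measurable_funM; first exact: measurable_abs2.
  apply: measurable_funM; last exact: measurable_cst.
  apply: measurableT_comp; first exact: measurable_expR.
  apply: measurable_funN; apply: measurable_funM; last exact: measurable_cst.
  exact: (measurable_abs2 _ entire_id).
have F0 p : (0 <= F p)%E.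
  by rewrite lee_fin; apply: mulr_ge0; [exact: abs2_ge0|rewrite divr_ge0 ?expR_ge0 ?pi_ge0].
rewrite -[RHS](ge0_integral_mulp a F a0 mF F0); congr (_ * _)%E.
apply: eq_integral => p _; rewrite /F !cpt_mulp abs2M mulrC /dil /gauss [_ * abs2 (cpt p)]mulrC mulfK ?gt_eqF //.
by rewrite mulrC.
Qed.

Lemma dil_conj_norm2E a f : entire f -> fock_norm2E (dil (conjc a) f) = fock_norm2E (dil a f).
Proof.
have [->|a0] := eqVneq a 0; first by rewrite conjc0.
have b0 : conjc a != 0 by rewrite conjc_eq0.
move=> ef; have A0 := abs2_gt0 a a0.
have : ((abs2 a)%:E * fock_norm2E (dil (conjc a) f) = (abs2 a)%:E * fock_norm2E (dil a f))%E.
  by rewrite [RHS](dil_norm2E a f a0 ef) -(abs2J a) (dil_norm2E (conjc a) f b0 ef).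
move/(congr1 (fun x => ((abs2 a)^-1)%:E * x)%E).
by rewrite !muleA -!EFinM mulVf ?gt_eqF // !mul1e.
Qed.

(** In the formula of [dil_norm2E], |a| <= 1 makes e^(-|z|^2 / |a|^2) at most e^(-|z|^2). *)
Lemma dil_norm2E_le a f : a != 0 -> abs2 a <= 1 -> entire f ->
  ((abs2 a)%:E * fock_norm2E (dil a f) <= fock_norm2E f)%E.
Proof.
move=> a0 a1 ef; have A0 := abs2_gt0 a a0; rewrite dil_norm2E //.
apply: ge0_le_integral => //.
- by move=> p _; rewrite lee_fin; apply: mulr_ge0; [exact: abs2_ge0|rewrite divr_ge0 ?expR_ge0 ?pi_ge0].
- apply/measurable_EFinP; apply: measurable_funM; first exact: measurable_abs2.
  apply: measurable_funM; last exact: measurable_cst.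
  apply: measurableT_comp; first exact: measurable_expR.
  apply: measurable_funN; apply: measurable_funM; last exact: measurable_cst.
  exact: (measurable_abs2 _ entire_id).
- exact: (measurable_mul_gauss _ (measurable_abs2 f ef)).
- move=> p _; rewrite lee_fin; apply: ler_wpM2l; first exact: abs2_ge0.
  rewrite /gauss ler_wpM2r ?invr_ge0 ?pi_ge0 // ler_expR lerN2 ler_peMr ?abs2_ge0 //.
  by rewrite invf_ge1.
Qed.

Lemma dil0 f : dil 0 f = (fun=> f 0).
Proof. by apply/funext => z; rewrite /dil mul0r. Qed.

Lemma inF2_dil a f : abs2 a <= 1 -> inF2 f -> inF2 (dil a f).
Proof.
have [->|a0] := eqVneq a 0; first by move=> _ _; rewrite dil0; exact: inF2_cst.
move=> a1 [ef nf]; split; first exact: entire_dil.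
have A0 := abs2_gt0 a a0.
have H := le_lt_trans (dil_norm2E_le a f a0 a1 ef) nf.
rewrite ltNge leye_eq; apply/negP => /eqP E; move: H; rewrite E.
by rewrite mulry gtr0_sg // mul1e ltxx.
Qed.

(** For a = 0 the substitution degenerates, but [dil 0] is evaluation at 0, controlled by
    [abs2_0_le]. Otherwise the Jacobian gives the constant |a|^(-2). *)
Lemma dil_bound a : abs2 a <= 1 -> exists M : R, forall f, inF2 f ->
  fock_norm2 (dil a f) <= M * fock_norm2 f.
Proof.
have [->|a0] := eqVneq a 0.
  move=> _; exists 1 => f nf; rewrite dil0 mul1r; apply: le_trans (abs2_0_le f nf).
  have -> : (fun=> f 0) = (fun z : R[i] => f 0 * 1) by apply/funext => z; rewrite mulr1.
  by rewrite norm2Z ?norm2_1 ?mulr1 //; exact: inF2_cst.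
move=> a1; have A0 := abs2_gt0 a a0; exists (abs2 a)^-1 => f nf; have [ef nfE] := nf.
have [_ ndE] := inF2_dil a f a1 nf.
have fin h : (fock_norm2E h < +oo)%E -> (fock_norm2 h)%:E = fock_norm2E h.
  move=> hE; rewrite /fock_norm2 fineK // ge0_fin_numE //.
  apply: integral_ge0 => p _; rewrite lee_fin; apply: mulr_ge0; [exact: abs2_ge0|exact: gauss_ge0].
have := dil_norm2E_le a f a0 a1 ef; rewrite -(fin _ ndE) -(fin _ nfE) -EFinM lee_fin.
by rewrite mulrC -ler_pdivlMr // mulrC.
Qed.

Lemma dil_conj_norm2 a f : entire f -> fock_norm2 (dil (conjc a) f) = fock_norm2 (dil a f).
Proof. by move=> ef; rewrite /fock_norm2 dil_conj_norm2E. Qed.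

Lemma dil_adjoint_unit a f g : abs2 a = 1 -> entire f -> entire g ->
  fock_inner (dil a f) g = fock_inner f (dil (conjc a) g).
Proof.
move=> a1 ef eg; have [m1 m2] := measurable_mulJ f _ ef (entire_dil (conjc a) g eg).
have aJ : conjc a * a = 1.
  by move: a1; case: (a) => x y; rewrite /abs2 /= => a1; apply/eqP; rewrite eq_complex /=; apply/andP; split; apply/eqP; rewrite -?a1; ring.
have ga p : gauss (mulp a p) = gauss p by rewrite /gauss cpt_mulp abs2M a1 mul1r.
have E p : dil a f (cpt p) * (g (cpt p))^* = f (cpt (mulp a p)) * (dil (conjc a) g (cpt (mulp a p)))^*.
  by rewrite /dil cpt_mulp mulrA aJ mul1r.
rewrite !fock_innerE; congr (_ +i* _); rewrite /gauss_int /Rintegral; congr fine.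
  rewrite -[RHS](integral_rot a _ a1 (measurable_mul_gauss _ m1)).
  by apply: eq_integral => p _; rewrite ga E.
rewrite -[RHS](integral_rot a _ a1 (measurable_mul_gauss _ m2)).
by apply: eq_integral => p _; rewrite ga E.
Qed.

(** No change of variables matches the two integrands, but [mean_dilation] equates their means over
    every circle, which [eq_circle_mean] integrates. *)
Lemma dil_adjoint_real (r : R) f g : 0 < r -> r <= 1 -> inF2 f -> inF2 g ->
  fock_inner (dil r%:C f) g = fock_inner f (dil r%:C g).
Proof.
move=> r0 r1 nf ng; have [ef _] := nf; have [eg _] := ng.
have r2 : abs2 (r%:C) <= 1 by rewrite /abs2 /= expr0n addr0 expr_le1 // ltW.
have nrf := inF2_dil _ f r2 nf; have nrg := inF2_dil _ g r2 ng.
have erf := entire_dil r%:C f ef; have erg := entire_dil r%:C g eg.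
have [i1 i2] := gauss_integrable_mulJ _ g nrf ng; have [i3 i4] := gauss_integrable_mulJ f _ nf nrg.
have [m1 m2] := measurable_mulJ _ g erf eg; have [m3 m4] := measurable_mulJ f _ ef erg.
have c1 := continuous_rot_mulJ _ g erf eg; have c2 := continuous_rot_mulJ f _ ef erg.
rewrite !fock_innerE; congr (_ +i* _); apply: eq_circle_mean => //.
- by move=> p; exact: (c1 p).1.
- by move=> p; exact: (c2 p).1.
- move=> p; rewrite (_ : (fun t => _) = (fun t => complex.Re (f (r%:C * (expC (0 +i* t) * cpt p)) * (g (expC (0 +i* t) * cpt p))^*))).
    rewrite (mean_dilation f g (cpt p) r ef eg r0).1; congr (segint _ _ _); apply/funext => t.
    by rewrite cpt_rot.
  by apply/funext => t; rewrite cpt_rot.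
- by move=> p; exact: (c1 p).2.
- by move=> p; exact: (c2 p).2.
- move=> p; rewrite (_ : (fun t => _) = (fun t => complex.Im (f (r%:C * (expC (0 +i* t) * cpt p)) * (g (expC (0 +i* t) * cpt p))^*))).
    rewrite (mean_dilation f g (cpt p) r ef eg r0).2; congr (segint _ _ _); apply/funext => t.
    by rewrite cpt_rot.
  by apply/funext => t; rewrite cpt_rot.
Qed.

Lemma inner_cstl c g : inF2 g -> fock_inner (fun=> c) g = c * conjc (g 0).
Proof.
move=> ng; have -> : (fun=> c) = (fun z : R[i] => c * 1) by apply/funext => z; rewrite mulr1.
have n1 : inF2 (fun=> 1 : R[i]) := inF2_cst 1.
by rewrite innerZl // (innerC g _ ng n1) inner_1.
Qed.

Lemma dil_adjoint a f g : abs2 a <= 1 -> inF2 f -> inF2 g ->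
  fock_inner (dil a f) g = fock_inner f (dil (conjc a) g).
Proof.
have [->|a0] := eqVneq a 0.
  move=> _ nf ng; rewrite conjc0 !dil0 inner_cstl //.
  rewrite (innerC (fun=> g 0) f (inF2_cst _) nf) inner_cstl // conjM.
  by rewrite conjcK mulrC.
move=> a1 nf ng; have [ef _] := nf; have [eg _] := ng; have A0 := abs2_gt0 a a0.
(* Polar form a = u r: [r] is treated by circle means and [u] by rotation invariance. *)
pose r := Num.sqrt (abs2 a); pose u := a / r%:C.
have r0 : 0 < r by rewrite sqrtr_gt0.
have r1 : r <= 1 by rewrite -sqrtr1 ler_wsqrtr.
have rC0 : r%:C != 0 :> R[i] by rewrite fmorph_eq0 gt_eqF.
have abs2r : abs2 (r%:C) = abs2 a by rewrite /abs2 /= expr0n addr0 sqr_sqrtr // ltW.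
have u1 : abs2 u = 1 by rewrite /u abs2M abs2V abs2r mulfV // gt_eqF.
have au : a = u * r%:C by rewrite /u divfK.
have -> : dil a f = dil r%:C (dil u f) by apply/funext => z; rewrite /dil mulrA -au.
have -> : dil (conjc a) g = dil (conjc u) (dil r%:C g).
  by apply/funext => z; rewrite /dil mulrA au conjM conjc_real; congr (g (_ * _)); exact: mulrC.
have u1' : abs2 u <= 1 by rewrite u1.
rewrite (dil_adjoint_real r (dil u f) g r0 r1 (inF2_dil u f u1' nf) ng).
exact: (dil_adjoint_unit u f _ u1 ef (entire_dil r%:C g eg)).
Qed.

End Dilation.

(** * The two implications at operator level *)

Section Cohyponormality.
Context {R : realType}.
Implicit Types (f g psi : R[i] -> R[i]) (a b c p q z w : R[i]).

(** Through [pointwise_bound], a null norm gives vanishing at every point, not just almost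
    everywhere. *)
Lemma norm2_eq0 f : inF2 f -> fock_norm2 f <= 0 -> forall z, f z = 0.
Proof.
move=> nf f0 z; apply/eqP; rewrite -[_ == 0]negbK; apply/negP => /abs2_gt0.
rewrite ltNge => /negP; apply; apply: le_trans (pointwise_bound f z nf) _.
by rewrite mulr_ge0_le0 ?expR_ge0.
Qed.

(** The adjoint reverses the factors and inverts the unitaries. In both cases of the disjunction the
    norms of T f and of its adjoint at f are in fact equal, so T is normal. *)
Lemma weyl_dil_cohyponormal (T : (R[i] -> R[i]) -> (R[i] -> R[i])) c p a q :
  abs2 a <= 1 -> (a = 1 \/ q = - p) ->
  (forall f, T f = (fun z => c * weyl p (dil a (weyl q f)) z)) -> cohyponormal_F2 T.
Proof.
move=> a1 apq TE; have aJ1 : abs2 (conjc a) <= 1 by rewrite abs2J.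
pose S g := (fun z => conjc c * weyl (- q) (dil (conjc a) (weyl (- p) g)) z).
have nT f : inF2 f -> inF2 (T f).
  by move=> nf; rewrite TE; apply/inF2Z/inF2_weyl/inF2_dil/inF2_weyl.
have nU f : inF2 f -> inF2 (dil a (weyl q f)) by move=> nf; exact/inF2_dil/inF2_weyl.
have nV g : inF2 g -> inF2 (dil (conjc a) (weyl (- p) g)) by move=> ng; exact/inF2_dil/inF2_weyl.
split; first split => //.
  have [M HM] := dil_bound a a1; exists (abs2 c * M) => f nf; have [ef _] := nf.
  rewrite TE norm2Z; last exact/inF2_weyl/nU.
  rewrite weyl_norm; last exact/entire_dil/entire_weyl.
  rewrite -mulrA; apply: ler_wpM2l; first exact: abs2_ge0.
  by rewrite -(weyl_norm q f ef); apply: HM; exact: inF2_weyl.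
exists S; split; first split.
- by move=> g ng; apply/inF2Z/inF2_weyl/nV.
- move=> f g nf ng; have [ef _] := nf; have [eg _] := ng.
  have nUf := nU f nf; have nVg := nV g ng.
  have eU := entire_dil a _ (entire_weyl q f ef); have eV := entire_dil (conjc a) _ (entire_weyl (- p) g eg).
  have E1 : fock_inner (T f) g = c * fock_inner (weyl p (dil a (weyl q f))) g.
    by rewrite TE; exact: (innerZl c _ g (inF2_weyl p _ nUf) ng).
  have E2 : fock_inner f (S g) = c * fock_inner f (weyl (- q) (dil (conjc a) (weyl (- p) g))).
    rewrite -[c in RHS]conjcK; exact: (innerZr (conjc c) f _ nf (inF2_weyl (- q) _ nVg)).
  rewrite E1 E2 (weyl_adjoint p _ g eU eg).
  rewrite (dil_adjoint a _ _ a1 (inF2_weyl q f nf) (inF2_weyl (- p) g ng)).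
  by rewrite (weyl_adjoint q f _ ef eV).
- move=> f nf; have [ef _] := nf.
  have eU := entire_dil a _ (entire_weyl q f ef); have eV := entire_dil (conjc a) _ (entire_weyl (- p) f ef).
  rewrite TE (norm2Z c _ (inF2_weyl p _ (nU f nf))) (norm2Z (conjc c) _ (inF2_weyl (- q) _ (nV f nf))).
  rewrite (weyl_norm p _ eU) (weyl_norm (- q) _ eV).
  rewrite abs2J; apply: ler_wpM2l; first exact: abs2_ge0.
  case: apq => [a_1|->].
    have dil1 h : dil 1 h = h by apply/funext => z; rewrite /dil mul1r.
    by rewrite a_1 conjc1 !dil1 !weyl_norm.
  by rewrite (dil_conj_norm2 a _ (entire_weyl (- p) f ef)) lexx.
Qed.

(** Expanding U_p D_a U_q f at z gives f(a (z - p) - q) times an exponential whose linear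
    coefficient is conj p + a conj q. The constant part of that exponent is -d, compensated in the
    scalar. *)
Lemma wcomp_weyl psi p a q (k : R[i]) : psi = (fun z => psi 0 * expC (k * z)) ->
  k = conjc p + conjc q * a -> exists c, forall f,
  wcomp psi (fun z => a * z - (a * p + q)) f = (fun z => c * weyl p (dil a (weyl q f)) z).
Proof.
move=> psiE kE; have psiz z : psi z = psi 0 * expC (k * z) by rewrite [in LHS]psiE.
pose d := (abs2 p / 2)%:C + conjc q * (a * p) + (abs2 q / 2)%:C.
exists (psi 0 * expC d) => f; apply/funext => z; rewrite /wcomp psiz.
have -> : k * z = d + (conjc p * z - (abs2 p / 2)%:C + (conjc q * (a * (z - p)) - (abs2 q / 2)%:C)).
  by rewrite kE /d; ring.
have -> : a * z - (a * p + q) = a * (z - p) - q by ring.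
have assoc (m A B C D : R[i]) : m * (A * (B * C)) * D = m * A * (B * (C * D)) by ring.
set B := conjc p * z - _; set C := conjc q * _ - _.
rewrite (expCD d) (expCD B C); exact: assoc.
Qed.

(* [K_p] is an eigenvector of the hyponormal operator [T^*] for the eigenvalue
   [conj (psi p)], hence of [T] for [psi p]. *)
Lemma cohyponormal_eigenvector psi (phi : R[i] -> R[i]) p :
  phi p = p -> cohyponormal_F2 (wcomp psi phi) ->
  forall z, psi z * fockK p (phi z) = psi p * fockK p z.
Proof.
move=> fixp [[TF2 _] [S [[SF2 adj] coh]]]; set T := wcomp psi phi in TF2 adj coh.
have nK := inF2_fockK p; set K := fockK p in nK *; set l := psi p.
have nT := TF2 K nK; have nS := SF2 K nK; have nTS := TF2 _ nS.
have Tp g : T g p = l * g p by rewrite /T /wcomp fixp.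
have Kp : (fock_norm2 K)%:C = K p by rewrite -(inner_norm K nK); exact: (reproducing K p nK).
have TK : fock_inner (T K) K = l * (fock_norm2 K)%:C.
  by rewrite (reproducing (T K) p nT) Tp Kp.
have SKp : S K p = conjc l * (fock_norm2 K)%:C.
  rewrite -(reproducing (S K) p nS) -/K (innerC K (S K) nK nS) -(adj K K nK nK) TK.
  by rewrite conjM conjc_real.
(* Only the norm of [S K] is computed: <S K, S K> = <T (S K), K> = T (S K) p = l (S K p), by
   adjunction, reproduction and the fixed point. *)
have SK : (fock_norm2 (S K))%:C = (abs2 l * fock_norm2 K)%:C.
  rewrite -(inner_norm (S K) nS) -(adj (S K) K nS nK) (reproducing _ p nTS) Tp SKp mulrA rmorphM /=.
  congr (_ * _).
  by case: (l) => x y; apply/eqP; rewrite eq_complex /abs2 /=; apply/andP; split; apply/eqP; ring.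
have SKn : fock_norm2 (S K) = abs2 l * fock_norm2 K by case: SK.
have nD : inF2 (fun z => T K z - l * K z).
  have -> : (fun z => T K z - l * K z) = (fun z => T K z + (- l) * K z) by apply/funext => z; rewrite mulNr.
  exact: (inF2D _ _ nT (inF2Z (- l) _ nK)).
(* The expansion is |T K|^2 - 2 |l|^2 |K|^2 + |l|^2 |K|^2, and cohyponormality bounds |T K|^2 by
   |l|^2 |K|^2. *)
have D0 : fock_norm2 (fun z => T K z - l * K z) <= 0.
  rewrite (norm2_subZ l (T K) K nT nK) TK !conjE.
  have -> : complex.Re (conjc l * (l * (fock_norm2 K)%:C)) = abs2 l * fock_norm2 K.
    by case: (l) => x y; rewrite /abs2 /=; ring.
  by have := coh K nK; rewrite SKn; lra.
by move=> z; apply/eqP; rewrite -subr_eq0; apply/eqP; exact: (norm2_eq0 _ nD D0 z).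
Qed.

Lemma bounded_translation psi b : entire psi ->
  bounded_on_F2 (wcomp psi (fun z => z + b)) -> forall z, psi z = psi 0 * expC (- (conjc b * z)).
Proof.
move=> epsi [TF2 [M HM]]; pose h z := psi z * expC (conjc b * z).
have eh : entire h := entireM _ _ epsi (entire_comp (@expC R) _ entire_expC (entireZ (conjc b) entire_id)).
have n1 : inF2 (fun=> 1 : R[i]) := inF2_cst 1.
have hM w : abs2 (h w) <= `|M|.
  (* The normalized kernel at phi(w) = w + b has norm 1 and |k(w + b)|^2 = e^(|w + b|^2). Against
     the growth e^(|w|^2) allowed to T k at w, what remains is |psi w|^2 e^(2 Re (conj b w) + |b|^2)
     <= M. *)
  set k := weyl (w + b) (fun=> 1); have nk : inF2 k := inF2_weyl (w + b) _ n1.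
  have k1 : fock_norm2 k = 1 by exact: (etrans (weyl_norm (w + b) _ (entire_cst 1)) norm2_1).
  have := le_trans (pointwise_bound _ w (TF2 k nk)) (ler_wpM2l (expR_ge0 _) (HM k nk)).
  rewrite k1 mulr1 /wcomp abs2M.
  have -> : abs2 (k (w + b)) = expR (abs2 (w + b)).
    have -> : k (w + b) = expC (conjc (w + b) * (w + b) - (abs2 (w + b) / 2)%:C) by exact: mulr1.
    rewrite abs2_expC; congr expR.
    by case: (w + b) => x y; rewrite /abs2 /=; field.
  have -> : abs2 (w + b) = abs2 w + (2 * complex.Re (conjc b * w) + abs2 b).
    by case: (w) => x y; case: (b) => u v; rewrite /abs2 /=; ring.
  rewrite expRD mulrCA ler_pM2l ?expR_gt0 // expRD mulrA => H.
  rewrite /h abs2M abs2_expC; apply: le_trans (ler_norm _); apply: le_trans H.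
  rewrite ler_peMr ?mulr_ge0 ?abs2_ge0 ?expR_ge0 //.
  by rewrite -[leLHS]expR0 ler_expR abs2_ge0.
have hb w : normc (h w) <= Num.sqrt `|M|.
  have -> : normc (h w) = Num.sqrt (abs2 (h w)) by case: (h w).
  exact: ler_wsqrtr.
move=> z; have := liouville h _ eh hb z; rewrite /h mulr0 expC0 mulr1 => <-.
by rewrite -mulrA -expCD subrr expC0 mulr1.
Qed.

End Cohyponormality.

Theorem theorem2p6 (R : realType) (psi : R[i] -> R[i]) (a b : R[i]) :
  entire psi -> `|a| <= 1 ->
  (cohyponormal_F2 (wcomp psi (fun z => a * z + b)) <->
   ((a != 1 -> psi = (fun z => psi 0 * fockK (b * (a^* - 1) / (a - 1)) z)) /\
    (a = 1 -> psi = (fun z => psi 0 * fockK (- b) z)))).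
Proof.
move=> epsi a1.
have a1' : abs2 a <= 1.
  move: a1; rewrite normc_def lecR -[X in _ <= X]sqrtr1 ler_sqrt // .
(* With d = 1 - a, this rewrites the conjugated kernel parameter of the statement as (conj p) (1 -
   a), where p = b / (1 - a) is the fixed point. *)
have kernel (d : R[i]) : d != 0 -> conjc (b * (conjc a - 1) / (- d)) = conjc (b / d) * (1 - a).
  move=> d0.
  have cB : conjc (conjc a - 1) = a - 1.
    by case: (a) => x y; apply/eqP; rewrite eq_complex /=; apply/andP; split; apply/eqP; ring.
  have cN : conjc (- d) = - conjc d by case: (d).
  by rewrite !conjM !conjc_inv cB cN invrN; ring.
have [a_1|a_1] := eqVneq a 1.
  subst a; split.
    move=> [bT _]; split => // _; apply/funext => z.
    have bT' : bounded_on_F2 (wcomp psi (fun z => z + b)).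
      by have -> : (fun z : R[i] => z + b) = (fun z => 1 * z + b) by apply/funext => w; rewrite mul1r.
    by rewrite (bounded_translation psi b epsi bT' z) /fockK !conjE rmorphN mulNr.
  move=> [_ /(_ erefl) psiE].
  (* For a = 1 the single unitary U_(-b) has symbol z + b and weight proportional to K_(-b). *)
  have [||c Hc] := @wcomp_weyl R psi (- b) 1 0 (conjc (- b)).
  - by [].
  - by rewrite conjc0 mul0r addr0.
  apply: (weyl_dil_cohyponormal _ c (- b) 1 0) => //; first by left.
  move=> f; rewrite -Hc; congr (wcomp psi _ f).
  by apply/funext => z; rewrite addr0 mulrN mul1r mul1r opprK.
have d0 : 1 - a != 0 by rewrite subr_eq0 eq_sym.
have kE : conjc (b * (conjc a - 1) / (a - 1)) = conjc (b / (1 - a)) * (1 - a).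
  by rewrite -kernel // opprB.
pose p := b / (1 - a).
split.
  move=> coh; split => [_|a1e]; last by rewrite a1e eqxx in a_1.
  have fixp : a * p + b = p.
    by apply: (mulIf d0); rewrite /p mulrDl mulrA mulrAC mulfVK // ; field.
  have H := cohyponormal_eigenvector psi _ p fixp coh.
  (* The eigenvector equation divided by e^(conj p phi(z)). The exponents at z and at 0 differ by
     (conj p) (1 - a) z, so psi(z) is psi(0) times the required kernel. *)
  have psiE z : psi z = psi p * expC (conjc p * z - conjc p * (a * z + b)).
    have Hz : psi z * expC (conjc p * (a * z + b)) = psi p * expC (conjc p * z) := H z.
    move: (conjc p * (a * z + b)) (conjc p * z) Hz => u v Hz.
    have eN : expC u * expC (- u) = 1 by rewrite -expCD subrr expC0.
    by rewrite (expCD v) mulrA -Hz -mulrA eN mulr1.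
  apply/funext => z; rewrite (psiE z) (psiE 0) /fockK !conjE kE -/p.
  set u := conjc p * z - _; set v := conjc p * 0 - _; set w := _ * z.
  have -> : u = v + w by rewrite /u /v /w; ring.
  by rewrite (expCD v w) mulrA.
move=> [/(_ isT) psiE _].
(* With q = -p the symbol is a z + (1 - a) p = a z + b and the linear coefficient is conj p - a conj
   p. *)
have [||c Hc] := @wcomp_weyl R psi p a (- p) (conjc p * (1 - a)).
- by apply: (etrans psiE); apply/funext => z; exact: (congr1 (fun k => psi 0 * expC (k * z)) kE).
- by rewrite rmorphN; ring.
apply: (weyl_dil_cohyponormal _ c p a (- p)) => //; first by right.
move=> f; rewrite -Hc; congr (wcomp psi _ f).
apply/funext => z; congr (_ + _).
by rewrite /p; field.
Qed.
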